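(* Let $(\mathbb V,\mathbb E,\mathbf P,\mathcal W)$ be a weighted Markovian graph satisfying assumptions (A) and (A$^*$) (see context), and let $\mathbf V_{\mathcal W}=\mathbf M^{(2)}-\mathbf M\circ\mathbf M$ be the matrix of variances of the weighted first passage times. Then for $(l,k)\in\mathbb E$, with $\mathbf P$ held fixed, $$\frac{\partial\mathbf V_{\mathcal W}}{\partial\mathbf W(l,k)}=\frac{\partial\mathbf M^{(2)}}{\partial\mathbf W(l,k)}-2\,\mathbf M\circ\frac{\partial\mathbf M}{\partial\mathbf W(l,k)},$$ where $$\frac{\partial\mathbf M}{\partial\mathbf W(l,k)}=\mathbf P(l,k)\Big[\mathbf Z\mathbf e_l\mathbf 1^\top-\mathbf 1\mathbf 1^\top[\mathbf Z\mathbf e_l\mathbf 1^\top]_{\mathrm{dg}}+\boldsymbol\pi(l)\big(\mathbf I-\mathbf Z+\mathbf 1\mathbf 1^\top[\mathbf Z]_{\mathrm{dg}}\big)\Xi^{-1}\Big]$$ and, writing $\mathbf M'=\frac{\partial\mathbf M}{\partial\mathbf W(l,k)}$ and $\mathbf A=\frac{\partial(\mathbf P\circ\mathbf W^{(2)})}{\partial\mathbf W(l,k)}$, $$\begin{aligned}\frac{\partial\mathbf M^{(2)}}{\partial\mathbf W(l,k)}={}&\mathbf Z\mathbf A\mathbf 1\mathbf 1^\top-\mathbf 1\mathbf 1^\top\big[\mathbf Z\mathbf A\mathbf 1\mathbf 1^\top\big]_{\mathrm{dg}}\\&+2\mathbf P(l,k)\Big[\mathbf Z\mathbf e_l\mathbf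 e_k^\top(\mathbf M-[\mathbf M]_{\mathrm{dg}})-\mathbf 1\mathbf 1^\top\big[\mathbf Z\mathbf e_l\mathbf e_k^\top(\mathbf M-[\mathbf M]_{\mathrm{dg}})\big]_{\mathrm{dg}}\Big]\\&+2\Big[\mathbf Z(\mathbf P\circ\mathbf W)(\mathbf M'-[\mathbf M']_{\mathrm{dg}})-\mathbf 1\mathbf 1^\top\big[\mathbf Z(\mathbf P\circ\mathbf W)(\mathbf M'-[\mathbf M']_{\mathrm{dg}})\big]_{\mathrm{dg}}\Big]\\&+\big(\mathbf I-\mathbf Z+\mathbf 1\mathbf 1^\top[\mathbf Z]_{\mathrm{dg}}\big)\frac{\partial[\mathbf M^{(2)}]_{\mathrm{dg}}}{\partial\mathbf W(l,k)},\end{aligned}$$ where the diagonal derivatives are given, for each $i\in\mathbb V$, by $$\frac{\partial\mathbf M^{(2)}(i,i)}{\partial\mathbf W(l,k)}=\frac{\boldsymbol\pi\mathbf A\mathbf 1}{\boldsymbol\pi(i)}+\frac{2\boldsymbol\pi(l)\mathbf P(l,k)\,\big[\mathbf M-[\mathbf M]_{\mathrm{dg}}\big](k,i)}{\boldsymbol\pi(i)}+\frac{2\big[\boldsymbol\pi(\mathbf P\circ\mathbf W)(\mathbf M'-[\mathbf M']_{\mathrm{dg}})\big]_i}{\boldsymbol\pi(i)}.$$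
   Context: Weighted Markovian graph $(\mathbb V,\mathbb E,\mathbf P,\mathcal W)$: $\mathbb V=\{1,\dots,n\}$; $\mathbb E\subseteq\mathbb V\times\mathbb V$; the graph is strongly connected; $\mathbf P$ is a row-stochastic $n\times n$ matrix with $\mathbf P(i,j)\ge 0$ for $(i,j)\in\mathbb E$ and $\mathbf P(i,j)=0$ otherwise, assumed irreducible and (unless otherwise stated) aperiodic. The weights $\mathcal W(i,j)$ (random, or deterministic as a special case) take values in $[\epsilon,\infty)$ for $(i,j)\in\mathbb E$, for some $\epsilon>0$, and are zero otherwise. Assumption (A): $\mathbf P$ has a unique stationary distribution $\boldsymbol\pi$ (a row vector), and $\mathbf W(i,j)=\mathbb E[\mathcal W(i,j)]<\infty$, $\mathbf W^{(2)}(i,j)=\mathbb E[\mathcal W(i,j)^2]<\infty$ for $(i,j)\in\mathbb E$. Assumption (A$^*$): the weight matrices $(\mathcal W(i,j;m))_{i,j}$, $m\ge1$, used at successive transitions $m=1,2,\dots$ are i.i.d. (with the law of $\mathcal W$); they are independent of the chain. Let $(\hat X_k)_{k\ge0}$ be the Markov chain with transition matrix $\mathbf P$. For $\hat X_0=i$ let $\hat\tau(i,j)=\inf\{m\ge1:\hat X_m=j\}$ (first return time if $i=j$) and $\tau(i,j)=\sum_{m=1}^{\hat\tau(i,j)}\mathcal W(\hat X_{m-1},\hat X_m;m)$. Set $\mathbf M(i,j)=\mathbb E[\tau(i,j)]$ and $\mathbf M^{(2)}(i,j)=\mathbb E[\tau(i,j)^2]$. The second-moment matrix $\mathbf W^{(2)}$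 is regarded as a (distribution-dependent) differentiable function of the mean weight matrix $\mathbf W$, and $\frac{\partial(\mathbf P\circ\mathbf W^{(2)})}{\partial\mathbf W(l,k)}$ is the corresponding entrywise derivative; e.g. for deterministic weights $\mathbf W^{(2)}(i,j)=\mathbf W(i,j)^2$ and this derivative is $2\mathbf W(l,k)\mathbf P(l,k)\mathbf e_l\mathbf e_k^\top$. Thus $\mathbf M$, $\mathbf M^{(2)}$, $\mathbf V_{\mathcal W}$ are functions of $\mathbf W$. Notation: $\circ$ is the entrywise product; $\mathbf 1$ is the all-ones column vector; $\mathbf e_l$ is the $l$-th standard basis column vector; $[\cdot]_{\mathrm{dg}}$ sets all off-diagonal entries of a matrix to zero; $\Xi=\mathrm{diag}(\boldsymbol\pi(1),\dots,\boldsymbol\pi(n))$; $\Pi=\mathbf 1\boldsymbol\pi$; $\mathbf Z=(\mathbf I-\mathbf P+\Pi)^{-1}$. *)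

(* Defs.v *)
From HB Require Import structures.
From mathcomp Require Import all_boot all_order all_algebra.
From mathcomp Require Import finmap.
From mathcomp Require Import all_classical all_reals all_analysis.

Set Implicit Arguments.
Unset Strict Implicit.
Unset Printing Implicit Defensive.

Import Order.TTheory GRing.Theory Num.Theory.
Import numFieldNormedType.Exports.

Local Open Scope classical_set_scope.
Local Open Scope ring_scope.

Section matrix_notions.
Context {R : realType} {n : nat}.
Implicit Types (A B P : 'M[R]_n) (pi : 'rV[R]_n) (E : rel 'I_n).

Definition hadamard A B : 'M[R]_n := \matrix_(i, j) (A i j * B i j).

Definition dg A : 'M[R]_n := \matrix_(i, j) (if i == j then A i j else 0).

Definition ones : 'cV[R]_n := const_mx 1.

Definition evec (l : 'I_n) : 'cV[R]_n := delta_mx l 0.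

Definition stochastic P : Prop :=
  (forall i j, 0 <= P i j) /\ (forall i, \sum_j P i j = 1).

Definition irreducible P : Prop :=
  forall i j, exists m, 0 < (P ^+ m) i j.

(* [d] is a common divisor of all the return times to [i]. *)
Definition aperiodic P : Prop :=
  forall i (d : nat),
    (forall m, (0 < m)%N -> 0 < (P ^+ m) i i -> (d %| m)%N) -> d = 1%N.

Definition strongly_connected E : Prop := forall i j, connect E i j.

Definition markovian_graph E P : Prop :=
  [/\ strongly_connected E,
      stochastic P,
      forall i j, ~~ E i j -> P i j = 0,
      irreducible P
    & aperiodic P].

Definition stationary P pi : Prop :=
  [/\ forall i, 0 <= pi 0 i, \sum_i pi 0 i = 1 & pi *m P = pi].

Definition unique_stationary P pi : Prop :=
  stationary P pi /\ forall pi', stationary P pi' -> pi' = pi.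

Definition Xi pi : 'M[R]_n := diag_mx pi.

Definition Pi_mx pi : 'M[R]_n := ones *m pi.

Definition Zmx P pi : 'M[R]_n := invmx (1%:M - P + Pi_mx pi).

End matrix_notions.

Section independence.
Context {d : measure_display} {T : measurableType d} {R : realType}.
Variable Pr : probability T R.

Definition independent_pair (F G : set (set T)) : Prop :=
  forall A B, F A -> G B -> Pr (A `&` B) = (Pr A * Pr B)%E.

Definition independent_family (I : choiceType) (F : I -> set (set T)) : Prop :=
  forall (J : {fset I}) (A : I -> set T),
    (forall i, i \in J -> F i (A i)) ->
    Pr (\bigcap_(i in [set` J]) A i) = (\prod_(i <- J) Pr (A i))%E.

(* The Markov property in product form, so that conditioning on a null past
   imposes nothing. *)
Definition markov_chain_from (n : nat) (P : 'M[R]_n) (i : 'I_n)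
    (X : nat -> T -> 'I_n) : Prop :=
  Pr [set w | X 0%N w = i] = 1%E /\
  forall (k : nat) (x : nat -> 'I_n) (b : 'I_n),
    Pr [set w | (forall s, (s <= k)%N -> X s w = x s) /\ X k.+1 w = b] =
    (Pr [set w | forall s, (s <= k)%N -> X s w = x s] * (P (x k) b)%:E)%E.

End independence.

(* The Borel sigma-algebra of R^(n x n). *)
Definition mx_borel (R : realType) (n : nat) : set (set 'M[R]_n) :=
  <<s [set B | exists i j (C : set R),
         measurable C /\ B = [set A : 'M[R]_n | C (A i j)]] >>.

(* A probability space carrying the random weight matrix [weight], the weight
   matrices [step_weight m] used at the transitions m = 1, 2, ...
   ([step_weight 0] is never used), and, for every start [i], a Markov chain
   [chain i] with transition matrix [P] issued from [i].  The chains for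
   different starts may be coupled arbitrarily: only the law of each one
   matters. *)
Record realization (R : realType) (n : nat) (P : 'M[R]_n) := Realization {
  disp : measure_display;
  space : measurableType disp;
  prob : probability space R;
  weight : space -> 'M[R]_n;
  step_weight : nat -> space -> 'M[R]_n;
  chain : 'I_n -> nat -> space -> 'I_n;
  measurable_weight : forall a b,
    measurable_fun setT (fun w => weight w a b);
  measurable_step_weight : forall m a b,
    measurable_fun setT (fun w => step_weight m w a b);
  measurable_chain : forall i k a,
    measurable (chain i k @^-1` [set a]);
  chainP : forall i, markov_chain_from prob P i (chain i)
}.

Arguments disp {R n P}.
Arguments space {R n P}.
Arguments prob {R n P}.
Arguments weight {R n P}.
Arguments step_weight {R n P}.
Arguments chain {R n P}.

Section weighted_graph.
Context {R : realType} {n : nat} {P : 'M[R]_n}.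
Implicit Types (E : rel 'I_n).

Definition weight_support E (G : realization P) : Prop :=
  exists2 eps : R, 0 < eps &
    forall w i j,
      (E i j -> eps <= weight G w i j /\
                forall m, (0 < m)%N -> eps <= step_weight G m w i j) /\
      (~~ E i j -> weight G w i j = 0 /\
                forall m, (0 < m)%N -> step_weight G m w i j = 0).

Definition mean_weight (G : realization P) : 'M[R]_n :=
  \matrix_(i, j) fine ('E_(prob G)[fun w => weight G w i j])%E.

Definition mean_weight2 (G : realization P) : 'M[R]_n :=
  \matrix_(i, j) fine ('E_(prob G)[fun w => (weight G w i j ^+ 2)%R])%E.

Definition weighted_markovian_graph E (G : realization P) : Prop :=
  markovian_graph E P /\ weight_support E G.

Definition finite_moments E (G : realization P) : Prop :=
  forall i j, E i j ->
    ('E_(prob G)[fun w => weight G w i j] < +oo)%E /\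
    ('E_(prob G)[fun w => (weight G w i j ^+ 2)%R] < +oo)%E.

Definition assumption_A E (pi : 'rV[R]_n) (G : realization P) : Prop :=
  unique_stationary P pi /\ finite_moments E G.

Definition sigma_step_weight (G : realization P) (m : nat) :
    set (set (space G)) :=
  preimage_set_system setT (step_weight G m) (@mx_borel R n).
Arguments sigma_step_weight : clear implicits.

Definition sigma_step_weights (G : realization P) : set (set (space G)) :=
  <<s \bigcup_(m in [set m | (0 < m)%N]) sigma_step_weight G m >>.
Arguments sigma_step_weights : clear implicits.

Definition sigma_chain (G : realization P) (i : 'I_n) : set (set (space G)) :=
  <<s [set A | exists k a, A = chain G i k @^-1` [set a]] >>.
Arguments sigma_chain : clear implicits.

Definition assumption_Astar (G : realization P) : Prop :=
  [/\ forall m B, (0 < m)%N -> mx_borel B ->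
        prob G (step_weight G m @^-1` B) = prob G (weight G @^-1` B),
      independent_family (prob G) (fun m : nat => sigma_step_weight G m.+1)
    & forall i,
        independent_pair (prob G) (sigma_step_weights G) (sigma_chain G i)].

(* [+oo] when [j] is never reached, the infimum of the empty set. *)
Definition hit_time (G : realization P) (i j : 'I_n) (w : space G) : \bar R :=
  ereal_inf [set x | exists m : nat,
    [/\ (1 <= m)%N, chain G i m w = j & x = m%:R%:E]].
Arguments hit_time : clear implicits.

Definition tau (G : realization P) (i j : 'I_n) (w : space G) : \bar R :=
  (\sum_(1 <= m <oo | m%:R%:E <= hit_time G i j w)
     (step_weight G m w (chain G i m.-1 w) (chain G i m w))%:E)%E.
Arguments tau : clear implicits.

(* The entries are expectations of [0, +oo]-valued variables; they are finite
   under the standing assumptions, and [fine] only casts them to [R]. *)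
Definition fpt_mean (G : realization P) : 'M[R]_n :=
  \matrix_(i, j) fine (\int[prob G]_w tau G i j w)%E.

Definition fpt_mean2 (G : realization P) : 'M[R]_n :=
  \matrix_(i, j) fine (\int[prob G]_w (tau G i j w ^+ 2))%E.

Definition fpt_var (G : realization P) : 'M[R]_n :=
  fpt_mean2 G - hadamard (fpt_mean G) (fpt_mean G).

End weighted_graph.

(* Main.v *)
From HB Require Import structures.
Require Import Defs.
From mathcomp Require Import all_boot all_order all_algebra.
From mathcomp Require Import finmap.
From mathcomp Require Import ring lra.
From mathcomp Require Import all_classical all_reals all_analysis.
From mathcomp Require Import measurable_realfun.

Import Order.TTheory GRing.Theory Num.Theory.
Import numFieldNormedType.Exports.

Local Open Scope classical_set_scope.
Local Open Scope ring_scope.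

Set Implicit Arguments.
Unset Strict Implicit.
Unset Printing Implicit Defensive.

(** Write J for the all-ones matrix, N for M - dg M, and compose Hadamard
    products with P first.  The theorem rests on the first-step equations

      M  = (P o W) J + P (M - dg M)
      M2 = (P o W2) J + 2 (P o W) (M - dg M) + P (M2 - dg M2)

    ([fpt_mean_eq], [fpt_mean2_eq]).  Both have the shape
    X = B + P (X - dg X), and such an equation has at most one solution, given
    by an explicit formula that is linear in B: multiplying by pi yields
    X i i = (pi B) i / pi i, and multiplying by Z, with Z (I - P) = I - Pi,
    recovers the other entries ([fpt_solutionP]).  So M is an affine function
    of the weight W l k, while M2 and the variance are a quadratic polynomial
    in it plus a linear image of the increment of the second moments of the
    weights.  Such functions are differentiated by hand ([derive_line]), and
    since the solution operator is linear, the derivative of M (of M2) is the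
    solution whose right-hand side is the derivative of B; this is the
    announced formula.

    The equations come from a computation along the trajectory.  For a fixed
    target j, let Q be P with column j set to zero.  With alive m the event
    that j is not visited at times 1, ..., m, the passage time from i is the
    increasing limit of the sums of the gains
    1_(alive m) W_(m+1)(X_m, X_(m+1)).  Splitting according to the states
    visited and using the independence of the weights gives, with entries taken
    at i ([gain_mean], [gain_mean2], [gain_cross]),

      E gain m            = Q^m (P o W) 1
      E gain m ^2         = Q^m (P o W2) 1
      E gain m gain m+1+q = Q^m (Q o W) Q^q (P o W) 1.

    Hence the first two moments of the partial sums obey linear recursions
    x (N+1) = b N + Q x N ([mean_iterateS], [mean2_iterateS]), and by monotone
    convergence the column j of M and of M2 is their limit.  The limits are
    finite because, P being irreducible, I - Q is invertible and the equation
    h = 1 + Q h has a nonnegative solution, multiples of which dominate the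
    recursions ([taboo_potential], [taboo_iteration_cvg]).  In the limit the
    recursions become the first-step equations. *)

(** * Linear algebra of the killed chain *)

Section taboo_matrix.
Context {R : realType} {n : nat}.
Implicit Types (A B X P : 'M[R]_n) (v : 'cV[R]_n).

Lemma unitmx_inj A : (forall v, A *m v = 0 -> v = 0) -> A \in unitmx.
Proof.
move=> Ainj; rewrite unitmxE unitfE -det_tr; apply/det0P => -[v v0 vA].
have vT0 : v^T = 0.
  by apply: Ainj; rewrite -[A]trmxK -trmx_mul vA trmx0.
by move: v0; rewrite -[v]trmxK vT0 trmx0 eqxx.
Qed.

(** The transition matrix of the chain killed when it enters [j]. *)
Definition taboo P (j : 'I_n) : 'M[R]_n :=
  \matrix_(a, b) (if b == j then 0 else P a b).

(** Removing the diagonal of [X] amounts, in column [j], to forbidding the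
    transitions into [j]; this turns the matrix equation for the passage times
    into one vector equation for each target. *)
Lemma col_taboo P X : P *m (X - dg X) =
  \matrix_(a < n, j < n) (taboo P j *m col j X) a 0.
Proof.
apply/matrixP => a b; rewrite !mxE; apply: eq_bigr => c _; rewrite !mxE.
by have [->|cb] := eqVneq c b; rewrite ?subrr ?mulr0 ?mul0r ?subr0.
Qed.

Context (P : 'M[R]_n).
Hypotheses (Psto : stochastic P) (Pirr : irreducible P).

Let P_ge0 a b : 0 <= P a b. Proof. by case: Psto. Qed.

Let P_sum a : \sum_b P a b = 1. Proof. by case: Psto. Qed.

Lemma taboo_ge0 j a b : 0 <= taboo P j a b.
Proof. by rewrite mxE; case: eqP. Qed.

Lemma taboo_le j a b : taboo P j a b <= P a b.
Proof. by rewrite mxE; case: eqP. Qed.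

Lemma expmx_ge0 m a b : 0 <= (P ^+ m) a b.
Proof.
elim: m a b => [|m ih] a b; first by rewrite expr0 mxE; case: eqP.
by rewrite exprSr mxE sumr_ge0// => c _; rewrite mulr_ge0.
Qed.

Lemma expmx_gt0S m a b : 0 < (P ^+ m.+1) a b ->
  exists2 c, 0 < (P ^+ m) a c & 0 < P c b.
Proof.
rewrite exprSr -mulmxE mxE => s_gt0.
have [||c /= c_gt0] := @psumr_neq0P _ _ xpredT
    (fun c => (P ^+ m) a c * P c b).
- by move=> c _; rewrite mulr_ge0// expmx_ge0.
- by apply/eqP; rewrite gt_eqF.
exists c; first by rewrite lt_def expmx_ge0 andbT; apply: contraTneq c_gt0 => ->; rewrite mul0r ltxx.
by rewrite lt_def P_ge0 andbT; apply: contraTneq c_gt0 => ->; rewrite mulr0 ltxx.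
Qed.

(** Maximum principle: from a state where [`|v|] is maximal, every possible
    transition avoids [j] and leads to another such state, so [j] could not be
    reached from there. *)
Lemma taboo_fixed_eq0 j v : taboo P j *m v = v -> v = 0.
Proof.
move=> Qv.
pose i0 := [arg max_(i > j) `|v i 0|]%O.
have v_le a : `|v a 0| <= `|v i0 0|.
  by rewrite /i0; case: arg_maxP => //= i _ /(_ a); exact.
have [v0|v_neq0] := eqVneq (v i0 0) 0.
  apply/matrixP => a b; rewrite !mxE ord1; apply/eqP.
  by rewrite -normr_le0 (le_trans (v_le a))// v0 normr0.
pose mu := `|v i0 0|.
have mu_gt0 : 0 < mu by rewrite normr_gt0.
have closed a b : `|v a 0| = mu -> 0 < P a b -> b != j /\ `|v b 0| = mu.
  move=> va Pab.
  pose g c := if c == j then 0 else `|v c 0|.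
  have g_le c : g c <= mu by rewrite /g; case: eqP => // _; exact: ltW.
  have /psumr_eq0P sum0 : forall c, true -> 0 <= P a c * (mu - g c).
    by move=> c _; rewrite mulr_ge0// subr_ge0.
  have /sum0 /(_ b isT) /eqP : \sum_c P a c * (mu - g c) = 0.
    apply/eqP; rewrite eq_le; apply/andP; split; last first.
      by rewrite sumr_ge0// => c _; rewrite mulr_ge0// subr_ge0.
    under eq_bigr do rewrite mulrBr.
    rewrite sumrB -mulr_suml P_sum mul1r subr_le0 -va -{1}Qv mxE.
    apply: (le_trans (ler_norm_sum _ _ _)); apply: ler_sum => c _.
    rewrite mxE /g; case: eqP => _; first by rewrite mul0r normr0 mulr0.
    by rewrite normrM ger0_norm.
  rewrite mulf_eq0 gt_eqF//= subr_eq0 /g => /eqP.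
  by case: (b =P j) => // _ m0; rewrite m0 ltxx in mu_gt0.
have closedX m a b : `|v a 0| = mu -> 0 < (P ^+ m) a b -> `|v b 0| = mu.
  move=> va; elim: m b => [|m ih] b.
    by rewrite expr0 mxE; case: eqP => [<-//|_]; rewrite ltxx.
  by move=> /expmx_gt0S[c /ih vc /(closed _ _ vc)[]].
have onlyj a : `|v a 0| = mu -> a = j.
  move=> va; have [[|m]] := Pirr a j.
    by rewrite expr0 mxE; case: eqP => // _; rewrite ltxx.
  by move=> /expmx_gt0S[c /(closedX _ _ _ va) vc /(closed _ _ vc)[]]; rewrite eqxx.
have [||b /= Pb] := @psumr_neq0P _ _ xpredT (fun b => P i0 b).
- by [].
- by rewrite P_sum; apply/eqP; rewrite oner_eq0.
by have [bj /onlyj] := closed i0 b erefl Pb; move/eqP: bj.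
Qed.

Lemma unitmx_taboo j : (1%:M - taboo P j) \in unitmx.
Proof.
apply: unitmx_inj => v; rewrite mulmxBl mul1mx => /eqP.
by rewrite subr_eq0 => /eqP/esym; exact: taboo_fixed_eq0.
Qed.

(** [h a] is the expected number of steps needed to reach [j] from [a].  The
    equation is solved by linear algebra; at a state [a] where the solution is
    minimal and negative it would give [1 + h a <= h a]. *)
Lemma taboo_potential j :
  exists2 h : 'cV[R]_n, (forall a, 0 <= h a 0) & h = ones + taboo P j *m h.
Proof.
pose h : 'cV[R]_n := invmx (1%:M - taboo P j) *m ones.
have hE : h = ones + taboo P j *m h.
  apply/eqP; rewrite -subr_eq; apply/eqP.
  by rewrite -{1}[h]mul1mx -mulmxBl mulmxA mulmxV ?unitmx_taboo// mul1mx.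
clearbody h; exists h => // a.
pose i0 := [arg min_(i < j) h i 0]%O.
have h_ge b : h i0 0 <= h b 0.
  by rewrite /i0; case: arg_minP => //= i _ /(_ b); exact.
apply: le_trans (h_ge a); rewrite leNgt; apply/negP => h0.
have /eqP : h i0 0 = (ones + taboo P j *m h) i0 0 by rewrite -hE.
rewrite !mxE => /eqP h0E.
have : h i0 0 <= \sum_b taboo P j i0 b * h b 0.
  apply: (@le_trans _ _ (\sum_b taboo P j i0 b * h i0 0)); last first.
    by apply: ler_sum => b _; rewrite ler_wpM2l// taboo_ge0.
  rewrite -mulr_suml -{1}[h i0 0]mul1r; apply: (ler_wnM2r (ltW h0)).
  by rewrite -(P_sum i0); apply: ler_sum => b _; exact: taboo_le.
by rewrite {1}h0E gerDr ler10.
Qed.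

Context (pi : 'rV[R]_n).
Hypothesis pi_stat : stationary P pi.

Let pi_mul : pi *m P = pi. Proof. by case: pi_stat. Qed.

Let pi_ones : pi *m ones = 1%:M :> 'M[R]_1.
Proof.
apply/matrixP => a b; rewrite !mxE !ord1 /=; case: pi_stat => _ <- _.
by apply: eq_bigr => c _; rewrite !mxE mulr1.
Qed.

Let P_ones : P *m ones = ones :> 'cV[R]_n.
Proof.
by apply/matrixP => a b; rewrite !mxE -(P_sum a); apply: eq_bigr => c _; rewrite !mxE mulr1.
Qed.

Lemma stationary_gt0 i : 0 < pi 0 i.
Proof.
have [pi_ge0 pi_sum _] := pi_stat.
have piX m : pi *m P ^+ m = pi.
  by elim: m => [|m ih]; rewrite ?expr0 ?mulmx1// exprS -mulmxE mulmxA pi_mul.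
have [||a /= pia] := @psumr_neq0P _ _ xpredT (fun b => pi 0 b).
- by [].
- by rewrite pi_sum; apply/eqP; rewrite oner_eq0.
have [m Pai] := Pirr a i.
rewrite -(piX m) mxE (bigD1 a)//= ltr_wpDr ?mulr_gt0// sumr_ge0// => b _.
by rewrite mulr_ge0// expmx_ge0.
Qed.

(** A vector killed by [I - P + Pi] is killed by [pi], hence fixed by [P], hence
    constant: subtracting its value at [b] leaves a fixed vector of the chain
    killed at [b]. *)
Lemma unitmx_fundamental : (1%:M - P + Pi_mx pi) \in unitmx.
Proof.
apply: unitmx_inj => v Av.
have pv : pi *m v = 0.
  have : pi *m ((1%:M - P + Pi_mx pi) *m v) = 0 by rewrite Av mulmx0.
  rewrite mulmxA mulmxDr mulmxBr mulmx1 pi_mul subrr add0r /Pi_mx.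
  by rewrite mulmxA pi_ones mul1mx.
have Pv : P *m v = v.
  apply/esym/eqP; rewrite -subr_eq0 -{1}[v]mul1mx -mulmxBl; apply/eqP.
  by move: Av; rewrite mulmxDl /Pi_mx -mulmxA pv mulmx0 addr0.
have v_const a b : v a 0 = v b 0.
  pose u : 'cV[R]_n := v - v b 0 *: ones.
  suff /matrixP/(_ a 0) : u = 0.
    by rewrite !mxE mulr1 => /eqP; rewrite subr_eq0 => /eqP.
  apply: (@taboo_fixed_eq0 b); rewrite -[RHS](_ : P *m u = u); last first.
    by rewrite mulmxBr Pv -scalemxAr P_ones.
  apply/matrixP => c e; rewrite !mxE; apply: eq_bigr => f _; rewrite !mxE.
  by case: eqP => [->|//]; rewrite ord1 mulr1 subrr !mulr0.
apply/matrixP => a b; rewrite ord1 [RHS]mxE.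
have /matrixP/(_ 0 0) := pv; rewrite !mxE => <-.
rewrite -[LHS]mul1r; have [_ <- _] := pi_stat; rewrite mulr_suml.
by apply: eq_bigr => c _; rewrite (v_const c a).
Qed.

Lemma fundamental_mulP : Zmx P pi *m P = Zmx P pi + Pi_mx pi - 1%:M.
Proof.
have ZV : Zmx P pi *m (1%:M - P + Pi_mx pi) = 1%:M.
  by rewrite mulVmx// unitmx_fundamental.
have Zones : Zmx P pi *m ones = ones :> 'cV[R]_n.
  have e : (1%:M - P + Pi_mx pi) *m ones = ones :> 'cV[R]_n.
    by rewrite mulmxDl mulmxBl mul1mx P_ones subrr add0r /Pi_mx -mulmxA pi_ones mulmx1.
  by rewrite -{1}e mulmxA ZV mul1mx.
have ZPi : Zmx P pi *m Pi_mx pi = Pi_mx pi by rewrite mulmxA Zones.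
move: ZV; rewrite mulmxDr mulmxBr mulmx1 ZPi => <-.
move: (Zmx P pi *m P) (Zmx P pi) (Pi_mx pi) => X Y V.
by apply/matrixP => a b; rewrite !mxE; lra.
Qed.

Local Notation J := (@ones R n *m (@ones R n)^T).

(** The solution of [X = B + P (X - dg X)]; the last factor is the diagonal of
    the solution. *)
Definition fpt_solution (B : 'M[R]_n) : 'M[R]_n :=
  let Z := Zmx P pi in
  Z *m B - J *m dg (Z *m B) +
  (1%:M - Z + J *m dg Z) *m diag_mx (\row_j ((pi *m B) 0 j / pi 0 j)).

Let J_dg (X : 'M[R]_n) : J *m dg X = \matrix_(i, j) X j j.
Proof.
apply/matrixP => a b; rewrite mxE [RHS]mxE (bigD1 b)//= big1 ?addr0.
  by rewrite !mxE big_ord1 !mxE eqxx !mul1r.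
by move=> c cb; rewrite !mxE (negPf cb) mulr0.
Qed.

Lemma fpt_solution_diag B j : fpt_solution B j j = (pi *m B) 0 j / pi 0 j.
Proof.
rewrite /fpt_solution !J_dg mul_mx_diag !mxE.
by rewrite eqxx subrr add0r subrK mul1r.
Qed.

(** Multiplying the equation by [pi] determines the diagonal of [X];
    multiplying it by [Z] determines [X] up to the row [pi X], which is then
    eliminated by looking at the diagonal again. *)
Lemma fpt_solutionP X B : X = B + P *m (X - dg X) -> X = fpt_solution B.
Proof.
move=> XE.
pose x : 'rV[R]_n := \row_j X j j.
have dgX : dg X = diag_mx x.
  by apply/matrixP => a b; rewrite !mxE; case: eqP => [->|]; rewrite ?mulr1n ?mulr0n.
have piB j : (pi *m B) 0 j / pi 0 j = x 0 j.
  have : pi *m X = pi *m (B + P *m (X - dg X)) by rewrite -XE.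
  rewrite mulmxDr mulmxA pi_mul mulmxBr addrCA -{1}[pi *m X]addr0 => /addrI/eqP.
  rewrite eq_sym subr_eq0 => /eqP ->.
  rewrite dgX mul_mx_diag mxE mulrAC mulfV ?mul1r//.
  by rewrite gt_eqF// stationary_gt0.
have -> : fpt_solution B = Zmx P pi *m B - J *m dg (Zmx P pi *m B) +
    (1%:M - Zmx P pi + J *m dg (Zmx P pi)) *m dg X.
  rewrite /fpt_solution dgX; congr (_ + _ *m diag_mx _).
  by apply/rowP => j; rewrite -piB mxE.
have PiX i j : (Pi_mx pi *m X) i j = (pi *m X) 0 j.
  by rewrite /Pi_mx -mulmxA mxE big_ord1 mxE mul1r.
have ZX : X = Pi_mx pi *m X + Zmx P pi *m B
    - (Zmx P pi + Pi_mx pi - 1%:M) *m dg X.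
  have : Zmx P pi *m X = Zmx P pi *m (B + P *m (X - dg X)) by rewrite -XE.
  rewrite mulmxDr mulmxA fundamental_mulP mulmxBr.
  set U := _ *m dg X; rewrite mulmxDl mulNmx mulmxDl mul1mx => /matrixP e.
  by apply/matrixP => a b; have := e a b; rewrite !mxE; lra.
have ZXE i j : X i j = (pi *m X) 0 j + (Zmx P pi *m B) i j
    - (Zmx P pi i j + pi 0 j - (i == j)%:R) * X j j.
  rewrite {1}ZX dgX mul_mx_diag mxE [in LHS]mxE PiX; congr (_ + _ + _).
  by rewrite !mxE big_ord1 !mxE mul1r.
rewrite !J_dg dgX mul_mx_diag; apply/matrixP => i j.
have := ZXE i j; have := ZXE j j; rewrite eqxx !mxE /=.
lra.
Qed.

End taboo_matrix.

Section taboo_iteration.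
Context {R : realType} {n : nat} (P : 'M[R]_n) (j : 'I_n).
Hypotheses (Psto : stochastic P) (Pirr : irreducible P).
Let Q := taboo P j.

Lemma cvg_mulmx_col (A : 'M[R]_n) (x : nat -> 'cV[R]_n) (y : 'cV[R]_n) :
  (forall a, x N a 0 @[N --> \oo] --> y a 0) ->
  forall a, (A *m x N) a 0 @[N --> \oo] --> (A *m y) a 0.
Proof.
move=> xy a; rewrite mxE; under eq_fun do rewrite mxE.
apply: cvg_big => [|b _]; first exact: add_continuous.
by apply: cvgM; [exact: cvg_cst|exact: xy].
Qed.

(** If [c] bounds all the [b N], then [c h] with [h = 1 + Q h] dominates the
    iterates, which increase because the [b N] do; so they converge, and the
    recursion passes to the limit. *)
Lemma taboo_iteration_cvg (x b : nat -> 'cV[R]_n) (b_oo : 'cV[R]_n) :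
  x 0%N = 0 -> (forall N, x N.+1 = b N + Q *m x N) ->
  (forall N a, 0 <= b N a 0) ->
  (forall a, nondecreasing_seq (fun N => b N a 0)) ->
  (forall a, b N a 0 @[N --> \oo] --> b_oo a 0) ->
  (forall a, nondecreasing_seq (fun N => x N a 0)) /\
  exists2 y : 'cV[R]_n,
    (forall a, x N a 0 @[N --> \oo] --> y a 0) & y = b_oo + Q *m y.
Proof.
move=> x0 xS b_ge0 b_nd b_cvg.
have Q_ge0 a c : 0 <= Q a c by exact: taboo_ge0.
have x_nd N a : x N a 0 <= x N.+1 a 0.
  elim: N a => [|N ih] a; first by rewrite xS x0 mulmx0 addr0 mxE.
  rewrite [in leRHS]xS [in leLHS]xS !mxE lerD//; first exact: b_nd.
  by apply: ler_sum => c _; rewrite ler_wpM2l.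
have x_nds a : nondecreasing_seq (fun N => x N a 0).
  by apply/nondecreasing_seqP => N; exact: x_nd.
split=> //.
have b_le N a : b N a 0 <= b_oo a 0.
  have := nondecreasing_cvgn_le (b_nd a) (cvgP _ (b_cvg a)) N.
  by rewrite (cvg_lim _ (b_cvg a)).
have [h h_ge0 hE] := taboo_potential Psto Pirr j.
pose c := \sum_a b_oo a 0.
have b_le_c N a : b N a 0 <= c.
  apply: le_trans (b_le N a) _; rewrite /c (bigD1 a)//= lerDl sumr_ge0// => e _.
  by apply: le_trans (b_le N e).
have x_le N a : x N a 0 <= c * h a 0.
  elim: N a => [|N ih] a.
    by rewrite x0 mxE mulr_ge0// (le_trans (b_ge0 0%N a)).
  rewrite xS hE !mxE mulrDr mulr1 lerD// mulr_sumr.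
  by apply: ler_sum => e _; rewrite mulrCA ler_wpM2l.
have x_cvg a : cvgn (fun N => x N a 0).
  apply: nondecreasing_is_cvgn => //; exists (c * h a 0) => _ [N _ <-].
  exact: x_le.
pose y : 'cV[R]_n := \col_a limn (fun N => x N a 0).
have xy a : x N a 0 @[N --> \oo] --> y a 0 by rewrite mxE; exact: x_cvg.
exists y => //; apply/matrixP => a e; rewrite ord1.
have xS_cvg : x N.+1 a 0 @[N --> \oo] --> (b_oo + Q *m y) a 0.
  have -> : (b_oo + Q *m y) a 0 = b_oo a 0 + (Q *m y) a 0 by rewrite mxE.
  under eq_fun do rewrite xS mxE.
  by apply: cvgD => //; exact: cvg_mulmx_col.
have /(cvg_lim _) <- // := xS_cvg.
by apply/esym/cvg_lim => //; by rewrite (cvg_shiftS (fun N => x N a 0)); exact: xy.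
Qed.

End taboo_iteration.

(** * Independence and expectation *)

Section independence_and_expectation.
Context d (T : measurableType d) (R : realType) (Pr : probability T R).
Implicit Types (f g : T -> R) (C : set T).

(** The law of the pair [(f, g)] is the product of the laws of [f] and [g], so
    Tonelli's theorem applies. *)
Lemma expectation_mul_indep f g :
  measurable_fun setT f -> measurable_fun setT g ->
  (forall w, 0 <= f w) -> (forall w, 0 <= g w) ->
  (forall A B : set R, measurable A -> measurable B ->
    Pr ((f @^-1` A) `&` (g @^-1` B)) = (Pr (f @^-1` A) * Pr (g @^-1` B))%E) ->
  (\int[Pr]_w (f w * g w)%:E = \int[Pr]_w (f w)%:E * \int[Pr]_w (g w)%:E)%E.
Proof.
move=> mf mg f0 g0 fg.
pose F : {mfun T >-> R} := HB.pack f (isMeasurableFun.Build _ _ _ _ _ mf).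
pose G : {mfun T >-> R} := HB.pack g (isMeasurableFun.Build _ _ _ _ _ mg).
have mH : measurable_fun setT (fun w => (f w, g w)).
  exact: measurable_fun_pair.
pose H : {mfun T >-> (R * R)%type} :=
  HB.pack (fun w => (f w, g w)) (isMeasurableFun.Build _ _ _ _ _ mH).
(* The laws live on the whole real line, so the identity is replaced there by
   the positive part, which agrees with it on the values of f and g. *)
pose phi (x : R) : \bar R := (Num.max x 0)%:E.
have mphi : measurable_fun [set: R] (phi : R -> \bar R).
  apply/measurable_EFinP; apply: measurable_maxr => //.
have phi0 x : (0 <= phi x)%E by rewrite lee_fin le_max lexx orbT.
have phi_ge0 x : 0 <= x -> phi x = x%:E by move=> x0; rewrite /phi max_l.
pose psi (z : R * R) : \bar R := (phi z.1 * phi z.2)%E.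
have mpsi : measurable_fun setT psi.
  apply: emeasurable_funM.
    exact: (measurableT_comp mphi measurable_fst).
  exact: (measurableT_comp mphi measurable_snd).
have psi0 z : (0 <= psi z)%E by rewrite mule_ge0.
transitivity (\int[Pr]_w (psi \o H) w)%E.
  by apply: eq_integral => w _; rewrite /comp /psi /= !phi_ge0 // EFinM.
rewrite -ge0_integral_distribution//.
have -> : (\int[distribution Pr H]_z psi z =
           \int[(distribution Pr F \x distribution Pr G)%E]_z psi z)%E.
  apply: eq_measure_integral => A mA _; apply/esym.
  have := @product_measure_unique _ _ _ _ _ (distribution Pr F)
    (distribution Pr G) (distribution Pr H).
  by apply => // A1 A2 mA1 mA2; exact: fg.
rewrite fubini_tonelli1// /fubini_F.
under eq_integral do rewrite /psi /= ge0_integralZl//.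
rewrite ge0_integralZr//; last exact: integral_ge0.
congr (_ * _)%E; rewrite ge0_integral_distribution//.
  by apply: eq_integral => w _; rewrite /= phi_ge0.
by apply: eq_integral => w _; rewrite /= phi_ge0.
Qed.

Lemma probability_fine (A : set T) : measurable A -> Pr A = (fine (Pr A))%:E.
Proof. by move=> mA; rewrite fineK// fin_num_measure. Qed.

(** Expresses the events of [g * \1_C] through those of [g] and [C], so that
    independence of the latter passes to the former. *)
Lemma probability_preimage_indic g C (X : set T) (B : set R) :
  measurable_fun setT g -> measurable C -> measurable X -> measurable B ->
  Pr (X `&` (fun w => g w * \1_C w) @^-1` B) =
  (Pr (X `&` (g @^-1` B `&` C)) +
   (if 0%R \in B then Pr X - Pr (X `&` C) else 0))%E.
Proof.
move=> mg mC mX mB.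
have mgB : measurable (g @^-1` B) by rewrite -[X in measurable X]setTI; exact: mg.
have -> : X `&` (fun w => g w * \1_C w) @^-1` B =
    (X `&` (g @^-1` B `&` C)) `|` (if 0%R \in B then X `\` (X `&` C) else set0).
  apply/seteqP; split=> w /=.
    move=> [Xw]; rewrite indicE; have [Cw|nCw] := pselect (C w).
      by rewrite mem_set// mulr1 => Bw; left.
    rewrite memNset// mulr0 => B0; right; rewrite mem_set//; split=> //.
    by case.
  move=> [[Xw [Bw Cw]]|]; first by rewrite indicE mem_set// mulr1.
  case: ifPn => // /set_mem B0 [Xw nXC]; rewrite indicE memNset ?mulr0//.
  by move=> Cw; exact: nXC.
rewrite measureU//.
- congr (_ + _)%E; case: ifPn => // _; rewrite ?measure0//.
  have mXC : measurable (X `&` C) by exact: measurableI.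
  by rewrite measureD// ?setIA ?setIid// ltey_eq fin_num_measure.
- by apply: measurableI => //; exact: measurableI.
- by case: ifPn => // _; apply: measurableD => //; exact: measurableI.
- case: ifPn => _; last by rewrite setI0.
  by apply/seteqP; split=> // w [[Xw [_ Cw]] [_]]; apply.
Qed.

Lemma expectation_mul_indic f g C :
  measurable_fun setT f -> measurable_fun setT g -> measurable C ->
  (forall w, 0 <= f w) -> (forall w, 0 <= g w) ->
  (forall A B : set R, measurable A -> measurable B ->
    Pr (f @^-1` A `&` (g @^-1` B `&` C)) =
    (Pr (f @^-1` A) * (Pr (g @^-1` B `&` C)))%E) ->
  (\int[Pr]_w (f w * (g w * \1_C w))%:E =
   \int[Pr]_w (f w)%:E * \int[Pr]_w (g w * \1_C w)%:E)%E.
Proof.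
move=> mf mg mC f0 g0 fgC.
have mgC : measurable_fun setT (fun w => g w * \1_C w).
  by apply: measurable_funM.
apply: expectation_mul_indep => //; first by move=> w; rewrite mulr_ge0.
move=> A B mA mB.
have mfA : measurable (f @^-1` A) by rewrite -[X in measurable X]setTI; exact: mf.
have mgB : measurable (g @^-1` B) by rewrite -[X in measurable X]setTI; exact: mg.
have fC : Pr (f @^-1` A `&` C) = (Pr (f @^-1` A) * Pr C)%E.
  by have := fgC A setT mA measurableT; rewrite preimage_setT setTI.
rewrite probability_preimage_indic//.
rewrite -[in RHS](setTI (_ @^-1` B)) probability_preimage_indic//.
rewrite !setTI fgC// fC probability_setT.
rewrite (probability_fine mfA) (probability_fine mC) [Pr (_ `&` C)]probability_fine; last exact: measurableI.
by case: ifPn => _; rewrite -?EFinM -?EFinB -?EFinD -?EFinM; congr (_%:E); lra.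
Qed.

(** Two applications of the product formula: [f] against [g * \1_C], then
    [g] against [\1_C]. *)
Lemma expectation_mul2_event f g C :
  measurable_fun setT f -> measurable_fun setT g -> measurable C ->
  (forall w, 0 <= f w) -> (forall w, 0 <= g w) ->
  (forall A B : set R, measurable A -> measurable B ->
    Pr (f @^-1` A `&` (g @^-1` B `&` C)) =
    (Pr (f @^-1` A) * (Pr (g @^-1` B) * Pr C))%E) ->
  (\int[Pr]_(w in C) (f w * g w)%:E =
   \int[Pr]_w (f w)%:E * (\int[Pr]_w (g w)%:E * Pr C))%E.
Proof.
move=> mf mg mC f0 g0 fgC.
have gC (B : set R) : measurable B -> Pr (g @^-1` B `&` C) = (Pr (g @^-1` B) * Pr C)%E.
  by move=> mB; have := fgC setT B measurableT mB; rewrite preimage_setT setTI probability_setT mul1e.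
transitivity (\int[Pr]_w (f w * (g w * \1_C w))%:E)%E.
  rewrite integral_mkcond; apply: eq_integral => w _.
  by rewrite patchE indicE; case: ifP; rewrite ?mulr1 ?mulr0.
rewrite expectation_mul_indic//; last by move=> A B mA mB; rewrite fgC// gC.
congr (_ * _)%E.
transitivity (\int[Pr]_w (g w * (1 * \1_C w))%:E)%E.
  by apply: eq_integral => w _; rewrite mul1r.
rewrite expectation_mul_indic//.
  congr (_ * _)%E; under eq_integral do rewrite mul1r.
  by rewrite integral_indic// setIT.
move=> A B mA mB; have [B1|nB1] := pselect (B 1).
  have -> : (fun=> 1) @^-1` B = [set: T] by apply/seteqP; split.
  by rewrite setTI gC.
have -> : (fun=> 1) @^-1` B = set0 :> set T by apply/seteqP; split.
by rewrite set0I setI0 measure0 mule0.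
Qed.

End independence_and_expectation.

(** * Events of a finite Markov chain *)

Section finite_partition.
Context d (T : measurableType d) (R : realType) (mu : {measure set T -> \bar R}).

Lemma integral_fin_partition (I : finType) (key : T -> I) (D : set T)
    (f : T -> \bar R) :
  (forall x, measurable (key @^-1` [set x])) -> measurable D ->
  measurable_fun D f -> (forall w, D w -> (0 <= f w)%E) ->
  (\int[mu]_(w in D) f w = \sum_x \int[mu]_(w in D `&` key @^-1` [set x]) f w)%E.
Proof.
move=> mkey mD mf f0.
have DE : D = \big[setU/set0]_(x <- index_enum I) (D `&` key @^-1` [set x]).
  rewrite -bigcup_seq; apply/seteqP; split=> w; last by move=> [x _] [].
  by move=> Dw; exists (key w) => //=; rewrite mem_index_enum.
rewrite {1}DE ge0_integral_bigsetU//.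
- by move=> x; exact: measurableI.
- exact: index_enum_uniq.
- by move=> x y _ _ [w /= [[_ <-] [_ <-]]].
- by rewrite -DE.
- by rewrite -DE.
Qed.

Lemma measure_fin_partition (I : finType) (key : T -> I) (D : set T) :
  (forall x, measurable (key @^-1` [set x])) -> measurable D ->
  mu D = (\sum_x mu (D `&` key @^-1` [set x]))%E.
Proof.
move=> mkey mD; have mDk x : measurable (D `&` key @^-1` [set x]).
  exact: measurableI.
have := @integral_fin_partition I key D (cst 1%E) mkey mD (measurable_cst _) (fun _ _ => lee01).
rewrite integral_cst// mul1e => ->.
by apply: eq_bigr => x _; rewrite integral_cst// mul1e.
Qed.

End finite_partition.

Section adapted.
Context {T : Type} {n : nat}.
Implicit Types (X : nat -> T -> 'I_n) (C : set T).

(** The event [C] is decided by the trajectory up to time [k].  Stated without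
    reference to a sigma-algebra, this is preserved by the obvious operations
    with no measurability argument; since there are finitely many trajectories
    of a given length, measurability follows ([adapted_measurable]). *)
Definition adapted X (k : nat) C :=
  forall w w', (forall s, (s <= k)%N -> X s w = X s w') -> C w -> C w'.

Lemma adaptedI X k C C' : adapted X k C -> adapted X k C' -> adapted X k (C `&` C').
Proof. by move=> aC aC' w w' ww' [Cw C'w]; split; [exact: (aC w)|exact: (aC' w)]. Qed.

Lemma adapted_le X k k' C : (k <= k')%N -> adapted X k C -> adapted X k' C.
Proof.
by move=> kk' aC w w' ww'; apply: aC => s sk; apply: ww'; exact: leq_trans kk'.
Qed.

Lemma adapted_state X k a : adapted X k (X k @^-1` [set a]).
Proof. by move=> w w' /(_ k (leqnn k)) /= ->. Qed.

Definition path X k w : {ffun 'I_k.+1 -> 'I_n} := [ffun s : 'I_k.+1 => X s w].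

Lemma pathP X k x : path X k @^-1` [set x] =
  [set w | forall s, (s <= k)%N -> X s w = x (inord s)].
Proof.
apply/seteqP; split=> w /=.
  by move=> <- s sk; rewrite ffunE inordK.
by move=> wx; apply/ffunP => s; rewrite ffunE wx ?inord_val// -ltnS.
Qed.

Lemma adaptedP X k C : adapted X k C ->
  forall x, C `&` path X k @^-1` [set x] = path X k @^-1` [set x] \/
            C `&` path X k @^-1` [set x] = set0.
Proof.
move=> aC x; have [[w [Cw wx]]|nC] := pselect (exists w, C w /\ path X k w = x).
  left; apply: setIidr => w' w'x; apply: aC Cw => s sk.
  by have := wx; rewrite -w'x => /ffunP/(_ (inord s)); rewrite !ffunE inordK.
by right; apply/seteqP; split=> // w [Cw wx]; apply: nC; exists w.
Qed.

End adapted.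

Section adapted_measurable.
Context d (T : measurableType d) (n : nat) (X : nat -> T -> 'I_n).
Hypothesis mX : forall k a, measurable (X k @^-1` [set a]).

Lemma measurable_path k x : measurable (path X k @^-1` [set x]).
Proof.
rewrite (_ : _ @^-1` _ = \big[setI/setT]_(s < k.+1) (X s @^-1` [set x s])).
  by apply: bigsetI_measurable => s _; exact: mX.
rewrite -bigcap_seq; apply/seteqP; split=> w /=.
  by move=> <- s _ /=; rewrite ffunE.
by move=> wx; apply/ffunP => s; rewrite ffunE; apply: wx; rewrite /= mem_index_enum.
Qed.

(** Being stated for any measurable structure on the sample space, this serves
    both for the ambient events and for the sigma-algebra generated by the
    chain. *)
Lemma adapted_measurable k C : adapted X k C -> measurable C.
Proof.
move=> aC; rewrite (_ : C = \big[setU/set0]_(x <- index_enum {ffun 'I_k.+1 -> 'I_n})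
    (C `&` path X k @^-1` [set x])).
  apply: bigsetU_measurable => x _.
  by have [->|->] := adaptedP aC x; [exact: measurable_path|exact: measurable0].
rewrite -bigcup_seq; apply/seteqP; split=> w; last by move=> [x _] [].
by move=> Cw; exists (path X k w) => //=; rewrite mem_index_enum.
Qed.

End adapted_measurable.

Section taboo_probabilities.
Context d (T : measurableType d) (R : realType) (Pr : probability T R).
Context (n : nat) (P : 'M[R]_n) (i : 'I_n) (X : nat -> T -> 'I_n).
Hypothesis mX : forall k a, measurable (X k @^-1` [set a]).
Hypothesis hX : markov_chain_from Pr P i X.

(** The Markov property, assumed for single trajectories, is summed over the
    trajectories that make up [C]. *)
Lemma adapted_markov k C a b : adapted X k C -> C `<=` X k @^-1` [set a] ->
  Pr (C `&` X k.+1 @^-1` [set b]) = (Pr C * (P a b)%:E)%E.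
Proof.
move=> aC Ca; have mC := adapted_measurable mX aC.
have mCb : measurable (C `&` X k.+1 @^-1` [set b]) by exact: measurableI.
rewrite (measure_fin_partition Pr (@measurable_path _ _ _ _ mX k) mCb).
rewrite (measure_fin_partition Pr (@measurable_path _ _ _ _ mX k) mC).
rewrite ge0_sume_distrl; last by move=> *; exact: measure_ge0.
apply: eq_bigr => x _; rewrite -setIA [X k.+1 @^-1` _ `&` _]setIC setIA.
have [Cx|->] := adaptedP aC x; last by rewrite set0I measure0 mul0e.
have [[w wx]|empty] := pselect (exists w, path X k w = x); last first.
  rewrite Cx (_ : path X k @^-1` [set x] = set0) ?set0I ?measure0 ?mul0e//.
  by apply/seteqP; split=> // w wx; apply: empty; exists w.
have xa : x (inord k) = a.
  have /Ca/= <- : C w by have : (path X k @^-1` [set x]) w by []; rewrite -Cx => -[].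
  by rewrite -wx ffunE inordK.
rewrite Cx pathP -xa.
by have [_ /(_ k (fun s => x (inord s)) b)] := hX.
Qed.

Definition avoids j k q : set T :=
  [set w | forall s, (k < s <= k + q)%N -> X s w <> j].

Lemma adapted_avoids j k q : adapted X (k + q) (avoids j k q).
Proof.
move=> w w' ww' aw s /andP[ks skq]; rewrite -ww'//.
by apply: aw; rewrite ks.
Qed.

(** Restarting after [C]: each further step that does not enter [j] contributes
    one factor [taboo P j]. *)
Lemma taboo_markov j k q C b c : adapted X k C -> C `<=` X k @^-1` [set b] ->
  Pr (C `&` avoids j k q `&` X (k + q)%N @^-1` [set c]) =
  (Pr C * ((taboo P j ^+ q) b c)%:E)%E.
Proof.
move=> aC Cb; have mC := adapted_measurable mX aC.
have aCq r : adapted X (k + r) (C `&` avoids j k r).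
  apply: adaptedI; last exact: adapted_avoids.
  by apply: adapted_le aC; rewrite leq_addr.
elim: q c => [|q ih] c.
  rewrite addn0 expr0 mxE.
  have -> : avoids j k 0 = setT.
    by apply/seteqP; split=> // w _ s; rewrite addn0 => /andP[/leq_trans h /h]; rewrite ltnn.
  rewrite setIT; case: eqP => [<-|bc]; first by rewrite mule1; congr (Pr _); exact: setIidl.
  rewrite mule0 (_ : _ `&` _ = set0) ?measure0//.
  by apply/seteqP; split=> // w [/Cb/= bw] /=; rewrite bw.
rewrite exprSr -mulmxE mxE.
have [->|cj] := eqVneq c j.
  rewrite big1 ?mule0; last by move=> e _; rewrite mxE eqxx mulr0.
  rewrite (_ : _ `&` _ = set0) ?measure0//; apply/seteqP; split=> // w.
  by move=> [[_ /(_ (k + q.+1)%N)] aw /= wj]; apply: aw wj; rewrite leqnn andbT addnS ltnS leq_addr.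
have -> : C `&` avoids j k q.+1 `&` X (k + q.+1)%N @^-1` [set c] =
    C `&` avoids j k q `&` X (k + q).+1 @^-1` [set c].
  rewrite addnS; apply/seteqP; split=> w [[Cw aw] /= wc]; split=> //; split=> // s.
    by move=> /andP[ks skq]; apply: aw; rewrite ks addnS leqW.
  move=> /andP[ks]; rewrite addnS leq_eqVlt => /orP[/eqP ->|skq].
    by rewrite wc; exact/eqP.
  by apply: aw; rewrite ks.
have mE : measurable (C `&` avoids j k q `&` X (k + q).+1 @^-1` [set c]).
  by apply: measurableI => //; exact: adapted_measurable (aCq q).
have -> : Pr (C `&` avoids j k q `&` X (k + q).+1 @^-1` [set c]) =
    (\sum_e Pr (C `&` avoids j k q `&` X (k + q).+1 @^-1` [set c] `&`
               X (k + q)%N @^-1` [set e]))%E.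
  exact: measure_fin_partition.
rewrite (probability_fine Pr mC).
transitivity (\sum_e (fine (Pr C) * ((taboo P j ^+ q) b e * taboo P j e c))%:E)%E.
  apply: eq_bigr => e _; rewrite setIAC.
  have aE : adapted X (k + q) (C `&` avoids j k q `&` X (k + q)%N @^-1` [set e]).
    by apply: adaptedI => //; exact: adapted_state.
  rewrite (@adapted_markov _ _ e c aE) => [|w []//].
  rewrite ih (probability_fine Pr mC) -!EFinM [taboo P j e c]mxE.
  by rewrite (negPf cj) mulrA.
by rewrite sumEFin -mulr_sumr.
Qed.

End taboo_probabilities.

(** * Laws of the random weights *)

Lemma same_law_integral d (T : measurableType d) (R : realType)
    (Pr : probability T R) (f g : T -> R) (phi : R -> \bar R) :
  measurable_fun setT f -> measurable_fun setT g ->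
  measurable_fun setT phi -> (forall x, (0 <= phi x)%E) ->
  (forall B : set R, measurable B -> Pr (f @^-1` B) = Pr (g @^-1` B)) ->
  (\int[Pr]_w phi (f w) = \int[Pr]_w phi (g w))%E.
Proof.
move=> mf mg mphi phi0 fg.
pose F : {mfun T >-> R} := HB.pack f (isMeasurableFun.Build _ _ _ _ _ mf).
pose G : {mfun T >-> R} := HB.pack g (isMeasurableFun.Build _ _ _ _ _ mg).
have := @ge0_integral_distribution _ _ _ _ _ Pr F _ mphi phi0; rewrite /comp /= => <-.
have := @ge0_integral_distribution _ _ _ _ _ Pr G _ mphi phi0; rewrite /comp /= => <-.
by apply: eq_measure_integral => A mA _; exact: fg.
Qed.

Section step_weights.
Context {R : realType} {n : nat} {P : 'M[R]_n} (G : realization P) (E : rel 'I_n).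
Hypotheses (Gsupp : weight_support E G) (Gfin : finite_moments E G)
  (Gstar : assumption_Astar G).
Local Notation Pr := (prob G).

Lemma weight_ge0 w a b : 0 <= weight G w a b.
Proof.
have [e e0 /(_ w a b)[hE hN]] := Gsupp.
have [/hE[/(le_trans (ltW e0))//]|/hN[->]//] := boolP (E a b).
Qed.

Lemma step_weight_ge0 m w a b : 0 <= step_weight G m.+1 w a b.
Proof.
have [e e0 /(_ w a b)[hE hN]] := Gsupp.
have [/hE[_ /(_ m.+1 isT)/(le_trans (ltW e0))//]|/hN[_ ->]//] := boolP (E a b).
Qed.

Lemma mx_borel_entry a b (B : set R) : measurable B ->
  mx_borel [set A : 'M[R]_n | B (A a b)].
Proof. by move=> mB; apply: sub_sigma_algebra; exists a, b, B. Qed.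

Lemma step_weight_law m a b (B : set R) : measurable B ->
  Pr ((fun w => step_weight G m.+1 w a b) @^-1` B) =
  Pr ((fun w => weight G w a b) @^-1` B).
Proof.
move=> mB; have [law _ _] := Gstar.
exact: (law m.+1 [set A : 'M[R]_n | B (A a b)] isT (mx_borel_entry a b mB)).
Qed.

Lemma sigma_step_weight_entry m a b (B : set R) : measurable B ->
  sigma_step_weight (G := G) m ((fun w => step_weight G m w a b) @^-1` B).
Proof.
move=> mB; exists [set A : 'M[R]_n | B (A a b)]; first exact: mx_borel_entry.
by rewrite setTI.
Qed.

(** Off the edges the weight vanishes, so the expectation is finite at every
    entry and is recovered from its real part. *)
Lemma mean_weightP a b :
  (\int[Pr]_w (weight G w a b)%:E = (mean_weight G a b)%:E)%E.
Proof.
have ge0 : (0 <= \int[Pr]_w (weight G w a b)%:E)%E.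
  by apply: integral_ge0 => w _; rewrite lee_fin weight_ge0.
rewrite mxE unlock fineK// ge0_fin_numE//.
have [/Gfin[+ _]|nE] := boolP (E a b); first by rewrite unlock.
rewrite integral0_eq// => w _; congr (_%:E).
by have [e _ /(_ w a b)[_ /(_ nE)[]]] := Gsupp.
Qed.

Lemma mean_weight2P a b :
  (\int[Pr]_w (weight G w a b ^+ 2)%:E = (mean_weight2 G a b)%:E)%E.
Proof.
have ge0 : (0 <= \int[Pr]_w (weight G w a b ^+ 2)%:E)%E.
  by apply: integral_ge0 => w _; rewrite lee_fin sqr_ge0.
rewrite mxE unlock fineK// ge0_fin_numE//.
have [/Gfin[_ +]|nE] := boolP (E a b); first by rewrite unlock.
rewrite integral0_eq// => w _; congr (_%:E).
by have [e _ /(_ w a b)[_ /(_ nE)[-> _]]] := Gsupp; rewrite expr0n.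
Qed.

(* A nonnegative function on the whole line, equal to the identity on the
   values of the weights. *)
Let clip (x : R) := Num.max x 0.

Let mclip : measurable_fun setT clip.
Proof. by apply: measurable_maxr. Qed.

Lemma step_mean m a b :
  (\int[Pr]_w (step_weight G m.+1 w a b)%:E = (mean_weight G a b)%:E)%E.
Proof.
rewrite -mean_weightP.
have mphi : measurable_fun setT (EFin \o clip) by exact/measurable_EFinP.
have phi0 x : (0 <= (EFin \o clip) x)%E by rewrite lee_fin le_max lexx orbT.
have := same_law_integral (measurable_step_weight m.+1 a b)
  (measurable_weight a b) mphi phi0 (step_weight_law m a b).
under eq_integral do rewrite /= /clip max_l ?step_weight_ge0//.
by move=> ->; apply: eq_integral => w _; rewrite /= /clip max_l ?weight_ge0.
Qed.

Lemma step_mean2 m a b :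
  (\int[Pr]_w (step_weight G m.+1 w a b ^+ 2)%:E = (mean_weight2 G a b)%:E)%E.
Proof.
rewrite -mean_weight2P.
have mphi : measurable_fun setT (fun x : R => (x ^+ 2)%:E).
  by apply/measurable_EFinP; exact: measurable_funX.
have phi0 (x : R) : (0 <= (x ^+ 2)%:E)%E by rewrite lee_fin sqr_ge0.
exact: same_law_integral (measurable_step_weight m.+1 a b)
  (measurable_weight a b) mphi phi0 (step_weight_law m a b).
Qed.

Section from_start.
Context (i : 'I_n).
Local Notation X := (chain G i).

Lemma adapted_sigma_chain k C : adapted X k C -> sigma_chain (G := G) i C.
Proof.
pose S := [set A : set (Defs.space G) | exists k a, A = X k @^-1` [set a]].
have mX k' a : @measurable _ (g_sigma_algebraType S) (X k' @^-1` [set a]).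
  by apply: sub_sigma_algebra; exists k', a.
by move=> aC; exact: (adapted_measurable mX aC).
Qed.

Lemma step_weight_indep1 m a b k C (A : set R) : adapted X k C -> measurable A ->
  Pr ((fun w => step_weight G m.+1 w a b) @^-1` A `&` C) =
  (Pr ((fun w => step_weight G m.+1 w a b) @^-1` A) * Pr C)%E.
Proof.
move=> /adapted_sigma_chain sC mA; have [_ _ /(_ i)] := Gstar; apply=> //.
by apply: sub_sigma_algebra; exists m.+1 => //; exact: sigma_step_weight_entry.
Qed.

Lemma step_weight_indep2 m m' a b c e k C (A B : set R) : m != m' ->
  adapted X k C -> measurable A -> measurable B ->
  Pr ((fun w => step_weight G m.+1 w a b) @^-1` A `&`
      ((fun w => step_weight G m'.+1 w c e) @^-1` B `&` C)) =
  (Pr ((fun w => step_weight G m.+1 w a b) @^-1` A) *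
    (Pr ((fun w => step_weight G m'.+1 w c e) @^-1` B) * Pr C))%E.
Proof.
move=> mm' /adapted_sigma_chain sC mA mB.
have [_ family /(_ i) pair] := Gstar.
set SA := _ @^-1` A; set SB := _ @^-1` B.
have sA : sigma_step_weight (G := G) m.+1 SA by exact: sigma_step_weight_entry.
have sB : sigma_step_weight (G := G) m'.+1 SB by exact: sigma_step_weight_entry.
have sAB : sigma_step_weights (G := G) (SA `&` SB).
  pose S := \bigcup_(m in [set m | (0 < m)%N]) sigma_step_weight (G := G) m.
  have mSA : @measurable _ (g_sigma_algebraType S) SA.
    by apply: sub_sigma_algebra; exists m.+1.
  have mSB : @measurable _ (g_sigma_algebraType S) SB.
    by apply: sub_sigma_algebra; exists m'.+1.
  exact: (measurableI _ _ mSA mSB).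
rewrite setIA pair// muleA; congr (_ * _)%E.
pose F s := if s == m then SA else SB.
have := family [fset m; m']%fset F.
rewrite big_fsetU1 ?inE//= big_seq_fset1 /F eqxx eq_sym (negPf mm').
move=> <-.
  congr (Pr _); apply/seteqP; split=> w.
    by move=> [wA wB] s _; rewrite /F; case: eqP.
  move=> wF; split.
    by have := wF m; rewrite /F eqxx; apply; rewrite /= !inE eqxx.
  have := wF m'; rewrite /F eq_sym (negPf mm'); apply.
  by rewrite /= !inE eqxx orbT.
by move=> s; rewrite !inE; case: eqP => [->//|_ /eqP ->].
Qed.

End from_start.
End step_weights.

(** * Moments of the successive gains *)

Section passage_moments.
Context {R : realType} {n : nat} {P : 'M[R]_n} (G : realization P) (E : rel 'I_n).
Hypotheses (Gsupp : weight_support E G) (Gfin : finite_moments E G)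
  (Gstar : assumption_Astar G).
Local Notation Pr := (prob G).
Context (i j : 'I_n).
Local Notation X := (chain G i).
Local Notation Q := (taboo P j).
Local Notation alive m := (avoids X j 0 m).

Let mX k a : measurable (X k @^-1` [set a]).
Proof. exact: measurable_chain. Qed.

Let hX : markov_chain_from Pr P i X. Proof. exact: chainP. Qed.

Let edge m w : 'I_n * 'I_n := (X m w, X m.+1 w).

Let edgeP m a b :
  edge m @^-1` [set (a, b)] = X m @^-1` [set a] `&` X m.+1 @^-1` [set b].
Proof.
by apply/seteqP; split=> w /=; [move=> [-> ->]|move=> [Xa Xb]; rewrite /edge Xa Xb].
Qed.

Let adapted_edge m x : adapted X m.+1 (edge m @^-1` [set x]).
Proof.
case: x => a b; rewrite edgeP; apply: adaptedI; last exact: adapted_state.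
by apply: (@adapted_le _ _ _ m); [|exact: adapted_state].
Qed.

Let measurable_edge m x : measurable (edge m @^-1` [set x]).
Proof. exact: (adapted_measurable mX (@adapted_edge m x)). Qed.

Let adapted_alive m : adapted X m (alive m).
Proof. by rewrite -{1}[m]add0n; exact: adapted_avoids. Qed.

Let measurable_alive m : measurable (alive m).
Proof. exact: (adapted_measurable mX (@adapted_alive m)). Qed.

(** The chain starts at [i] almost surely, so any event may be intersected with
    that start, which makes the Markov property applicable from time [0]. *)
Lemma probability_from_start D : measurable D ->
  Pr D = Pr (X 0%N @^-1` [set i] `&` D).
Proof.
move=> mD; have := @measure_fin_partition _ _ _ Pr _ (X 0%N) D (mX 0) mD.
move=> ->; rewrite (bigD1 i)//= big1 ?adde0; first by rewrite setIC.
move=> a ai; apply/eqP; rewrite eq_le measure_ge0 andbT.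
have Pstart : Pr (X 0%N @^-1` [set i]) = 1%E by case: hX.
have <- : Pr (~` (X 0%N @^-1` [set i])) = 0%E.
  by rewrite probability_setC// Pstart subee.
apply: le_measure; rewrite ?inE//; first exact: measurableI.
  exact: measurableC.
by move=> w [_ /= ->]; exact/eqP.
Qed.

Let start_edge_event m a b :
  let C := X 0%N @^-1` [set i] `&` alive m `&` X m @^-1` [set a] in
  adapted X m C /\ Pr (C `&` X m.+1 @^-1` [set b]) = ((Q ^+ m) i a * P a b)%:E.
Proof.
move=> C; have aC : adapted X m C.
  apply: adaptedI; last exact: adapted_state.
  by apply: adaptedI => //; apply: (@adapted_le _ _ _ 0%N) => //; exact: adapted_state.
have Ca : C `<=` X m @^-1` [set a] by move=> w [].
split=> //; rewrite (adapted_markov mX hX b aC Ca).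
have Pstart : Pr (X 0%N @^-1` [set i]) = 1%E by case: hX.
have := taboo_markov mX hX j m a (@adapted_state _ _ X 0%N i) (@subset_refl _ _).
by rewrite -/C Pstart mul1e => ->.
Qed.

Lemma edge_event m a b :
  Pr (alive m `&` edge m @^-1` [set (a, b)]) = ((Q ^+ m) i a * P a b)%:E.
Proof.
rewrite probability_from_start; last exact: measurableI.
rewrite edgeP !setIA.
by have [_] := start_edge_event m a b.
Qed.

(** The target is avoided up to the second transition; the factor [Q a b]
    records that [b] is not the target, and [Q ^+ q] the excursion from [b] to
    [c]. *)
Lemma edge2_event m q a b c e :
  Pr (alive (m.+1 + q) `&` (edge m @^-1` [set (a, b)] `&`
       edge (m.+1 + q) @^-1` [set (c, e)])) =
  ((Q ^+ m) i a * Q a b * (Q ^+ q) b c * P c e)%:E.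
Proof.
have [->|bj] := eqVneq b j.
  rewrite [Q a j]mxE eqxx mulr0 !mul0r.
  rewrite (_ : _ `&` _ = set0) ?measure0//; apply/seteqP; split=> // w.
  move=> [aw []]; rewrite edgeP => -[_ /= wj] _; apply: (aw m.+1) wj.
  by rewrite add0n leq_addr.
rewrite probability_from_start; last first.
  by apply: measurableI => //; apply: measurableI.
have [] := start_edge_event m a b.
set C := _ `&` X m @^-1` _ => aC PC.
pose D := C `&` X m.+1 @^-1` [set b].
have aD : adapted X m.+1 D.
  apply: adaptedI; last exact: adapted_state.
  by apply: adapted_le aC.
have Db : D `<=` X m.+1 @^-1` [set b] by move=> w [].
pose D' := D `&` avoids X j m.+1 q `&` X (m.+1 + q)%N @^-1` [set c].
have PD' : Pr D' = (((Q ^+ m) i a * P a b)%:E * ((Q ^+ q) b c)%:E)%E.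
  by rewrite /D' (taboo_markov mX hX j q c aD Db) /D PC.
have aD' : adapted X (m.+1 + q) D'.
  apply: adaptedI; last exact: adapted_state.
  apply: adaptedI; last exact: adapted_avoids.
  by apply: adapted_le aD; rewrite leq_addr.
have D'c : D' `<=` X (m.+1 + q)%N @^-1` [set c] by move=> w [].
have := adapted_markov mX hX e aD' D'c.
rewrite PD' -!EFinM [Q a b]mxE (negPf bj) => <-; congr (Pr _).
rewrite !edgeP /D' /D /C; apply/seteqP; split=> w.
  move=> [w0 [aw [[wa wb] [wc we]]]]; do !split=> //.
    by move=> s /andP[s0 sm]; apply: aw; rewrite s0 add0n (leq_trans sm)// addSn leqW// leq_addr.
  by move=> s /andP[ms sq]; apply: aw; rewrite add0n sq andbT (leq_trans _ ms).
move=> [[[[[[w0 aw] wa] wb] aw'] wc] we]; do !split=> //.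
move=> s /andP[s0 sq]; have [sm|ms|->] := ltngtP s m.+1.
- by apply: aw; rewrite s0 add0n -ltnS.
- by apply: aw'; rewrite ms.
- by move: wb => /= ->; exact/eqP.
Qed.

Definition step_gain m (w : Defs.space G) : R :=
  step_weight G m.+1 w (X m w) (X m.+1 w).

Lemma step_gain_ge0 m w : 0 <= step_gain m w.
Proof. exact: step_weight_ge0 Gsupp _ _ _ _. Qed.

Lemma measurable_step_gain m : measurable_fun setT (step_gain m).
Proof.
rewrite (_ : step_gain m = fun w =>
    \sum_x \1_(edge m @^-1` [set x]) w * step_weight G m.+1 w x.1 x.2).
  apply: measurable_sum => x; apply: measurable_funM => //.
  exact: measurable_step_weight.
apply/funext => w; rewrite (bigD1 (edge m w))//= big1 ?addr0.
  by rewrite indicE mem_set// mul1r.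
by move=> x xw; rewrite indicE memNset ?mul0r// => /= wx; rewrite wx eqxx in xw.
Qed.

(** The contribution of the transition [m.+1] to the passage time. *)
Definition gain m w : R := \1_(alive m) w * step_gain m w.

Lemma gain_ge0 m w : 0 <= gain m w.
Proof. by rewrite mulr_ge0// step_gain_ge0. Qed.

Lemma measurable_gain m : measurable_fun setT (gain m).
Proof. by apply: measurable_funM => //; exact: measurable_step_gain. Qed.

Let integral_indicM (D : set (Defs.space G)) (f : Defs.space G -> R) :
  (\int[Pr]_w (\1_D w * f w)%:E = \int[Pr]_(w in D) (f w)%:E)%E.
Proof.
rewrite [RHS]integral_mkcond; apply: eq_integral => w _.
by rewrite patchE indicE; case: ifP; rewrite ?mul1r ?mul0r.
Qed.

(** Covers the mean and the second moment at once, with [phi] the identity or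
    the square. *)
Lemma gain_moment (phi : R -> R) (U : 'M[R]_n) m :
  measurable_fun setT phi -> (forall x, 0 <= x -> 0 <= phi x) ->
  (forall a b, (\int[Pr]_w (phi (step_weight G m.+1 w a b))%:E = (U a b)%:E)%E) ->
  (\int[Pr]_w (\1_(alive m) w * phi (step_gain m w))%:E =
    ((Q ^+ m *m hadamard P U *m ones) i 0)%:E)%E.
Proof.
move=> mphi phi0 phiU; rewrite integral_indicM.
rewrite (@integral_fin_partition _ _ _ Pr _ (edge m))//; last 2 first.
- apply/measurable_EFinP/measurable_funTS/measurableT_comp => //.
  exact: measurable_step_gain.
- by move=> w _; rewrite lee_fin phi0// step_gain_ge0.
transitivity (\sum_x (U x.1 x.2 * ((Q ^+ m) i x.1 * P x.1 x.2))%:E)%E.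
  apply: eq_bigr => -[a b] _; set C := _ `&` _.
  have aC : adapted X m.+1 C.
    by apply: adaptedI => //; apply: adapted_le (@adapted_alive m).
  have mC := adapted_measurable mX aC.
  have mf : measurable_fun setT (fun w => phi (step_weight G m.+1 w a b)).
    by apply: measurableT_comp => //; exact: measurable_step_weight.
  transitivity (\int[Pr]_(w in C) (phi (step_weight G m.+1 w a b) * 1)%:E)%E.
    by apply: eq_integral => w /set_mem[_ [wa wb]]; rewrite mulr1 /step_gain wa wb.
  rewrite expectation_mul2_event//.
  - have -> : (\int[Pr]_w 1%:E = 1)%E.
      by rewrite integral_cst// mul1e; exact: probability_setT.
    by rewrite phiU mul1e EFinM; congr (_ * _)%E; exact: edge_event.
  - by move=> w; apply: phi0; exact: (step_weight_ge0 Gsupp).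
  - move=> A B mA mB; have mpA : measurable (phi @^-1` A).
      by rewrite -[Y in measurable Y]setTI; exact: mphi.
    have indep := step_weight_indep1 Gstar m a b aC mpA.
    have [B1|nB1] := pselect (B 1).
      have -> : (fun=> 1) @^-1` B = [set: Defs.space G] by apply/seteqP; split.
      by rewrite setTI probability_setT mul1e.
    have -> : (fun=> 1) @^-1` B = set0 :> set (Defs.space G).
      by apply/seteqP; split.
    by rewrite set0I setI0 measure0 mul0e mule0.
rewrite sumEFin; congr (_%:E).
rewrite -(pair_bigA _ (fun a b => U a b * ((Q ^+ m) i a * P a b)))/= -mulmxA mxE.
apply: eq_bigr => a _; rewrite !mxE mulr_sumr; apply: eq_bigr => b _.
by rewrite !mxE; ring.
Qed.

Lemma gain_mean m :
  (\int[Pr]_w (gain m w)%:E =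
    ((Q ^+ m *m hadamard P (mean_weight G) *m ones) i 0)%:E)%E.
Proof.
apply: (@gain_moment id) => // a b.
exact: (step_mean Gsupp Gfin Gstar).
Qed.

Lemma gain_mean2 m :
  (\int[Pr]_w (gain m w ^+ 2)%:E =
    ((Q ^+ m *m hadamard P (mean_weight2 G) *m ones) i 0)%:E)%E.
Proof.
rewrite -(@gain_moment (fun x => x ^+ 2)) => [|||a b].
- apply: eq_integral => w _; congr (_%:E); rewrite /gain exprMn.
  by rewrite indicE; case: (_ \in _); rewrite ?expr1n ?expr0n.
- exact: measurable_funX.
- by move=> x _; exact: sqr_ge0.
- exact: (step_mean2 Gsupp Gfin Gstar).
Qed.

Lemma gain_cross m q :
  (\int[Pr]_w (gain m w * gain (m.+1 + q) w)%:E =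
    ((Q ^+ m *m hadamard Q (mean_weight G) *m Q ^+ q *m
      hadamard P (mean_weight G) *m ones) i 0)%:E)%E.
Proof.
set W := mean_weight G; set m' := (m.+1 + q)%N.
have mm' : (m < m')%N by rewrite /m' addSn ltnS leq_addr.
have alive_le : alive m' `<=` alive m.
  move=> w aw s /andP[s0 sm]; apply: aw; rewrite s0 add0n.
  by rewrite (leq_trans sm)// ltnW.
transitivity (\int[Pr]_w (\1_(alive m') w * (step_gain m w * step_gain m' w))%:E)%E.
  apply: eq_integral => w _; congr (_%:E); rewrite /gain !indicE.
  have [/set_mem aw|_] := boolP (w \in alive m'); last by rewrite !mul0r mulr0.
  by rewrite mem_set ?mul1r//; exact: alive_le.
rewrite integral_indicM.
pose key w := (edge m w, edge m' w).
have keyE x : key @^-1` [set x] = edge m @^-1` [set x.1] `&` edge m' @^-1` [set x.2].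
  case: x => x y; apply/seteqP; split=> w; first by move=> [<- <-].
  by move=> [/= wx wy]; rewrite /key wx wy.
have akey x : adapted X m'.+1 (key @^-1` [set x]).
  by rewrite keyE; apply: adaptedI => //; apply: adapted_le (@adapted_edge m x.1); exact: leqW.
rewrite (@integral_fin_partition _ _ _ Pr _ key)//; last 3 first.
- by move=> x; exact: adapted_measurable (akey x).
- apply/measurable_EFinP/measurable_funTS/measurable_funM;
    exact: measurable_step_gain.
- by move=> w _; rewrite lee_fin mulr_ge0// step_gain_ge0.
transitivity (\sum_x (W x.1.1 x.1.2 * (W x.2.1 x.2.2 *
    ((Q ^+ m) i x.1.1 * Q x.1.1 x.1.2 * (Q ^+ q) x.1.2 x.2.1 * P x.2.1 x.2.2)))%:E)%E.
  apply: eq_bigr => -[[a b] [c e]] _; set C := _ `&` _.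
  have aC : adapted X m'.+1 C.
    by apply: adaptedI => //; apply: adapted_le (@adapted_alive m').
  have mC := adapted_measurable mX aC.
  transitivity (\int[Pr]_(w in C)
      (step_weight G m.+1 w a b * step_weight G m'.+1 w c e)%:E)%E.
    apply: eq_integral => w /set_mem[_]; rewrite keyE !edgeP => -[[wa wb] [wc we]].
    by rewrite /step_gain wa wb wc we.
  rewrite expectation_mul2_event//.
  - rewrite !(step_mean Gsupp Gfin Gstar) !EFinM; congr (_ * (_ * _))%E.
    by rewrite /C keyE edge2_event.
  - exact: measurable_step_weight.
  - exact: measurable_step_weight.
  - by move=> w; exact: (step_weight_ge0 Gsupp).
  - by move=> w; exact: (step_weight_ge0 Gsupp).
  - move=> A B mA mB; apply: (step_weight_indep2 Gstar a b c e _ aC mA mB).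
    by rewrite ltn_eqF.
rewrite sumEFin; congr (_%:E).
pose F x y := W x.1 x.2 * (W y.1 y.2 *
    ((Q ^+ m) i x.1 * Q x.1 x.2 * (Q ^+ q) x.2 y.1 * P y.1 y.2)).
rewrite -(pair_bigA _ F)/= -(pair_bigA _ (fun a b => \sum_y F (a, b) y))/=.
rewrite -!mulmxA mxE; apply: eq_bigr => a _; rewrite mxE mulr_sumr.
apply: eq_bigr => b _; rewrite [(Q ^+ q *m _) b 0]mxE !mulr_sumr.
rewrite -(pair_bigA _ (fun c e => F (a, b) (c, e)))/=.
apply: eq_bigr => c _; rewrite [(_ *m ones) c 0]mxE !mulr_sumr.
apply: eq_bigr => e _.
rewrite /F /= !mxE; ring.
Qed.

End passage_moments.

(** * First-step equations for the passage times *)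

Section passage_time_equations.
Context {R : realType} {n : nat} {P : 'M[R]_n} (G : realization P) (E : rel 'I_n).
Hypotheses (Gsupp : weight_support E G) (Gfin : finite_moments E G)
  (Gstar : assumption_Astar G).
Local Notation Pr := (prob G).

Section fixed_endpoints.
Context (i j : 'I_n).
Local Notation X := (chain G i).
Local Notation Q := (taboo P j).
Local Notation gain := (gain (G := G) i j).

Definition total_gain N w : R := \sum_(m < N) gain m w.

Let gain_ge0 m w : 0 <= gain m w. Proof. exact: (gain_ge0 Gsupp). Qed.

Let mgain m : measurable_fun setT (gain m). Proof. exact: measurable_gain. Qed.

Lemma total_gain_ge0 N w : 0 <= total_gain N w.
Proof. by rewrite sumr_ge0. Qed.

Lemma total_gain_nd w : nondecreasing_seq (total_gain^~ w).
Proof.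
by apply/nondecreasing_seqP => N; rewrite /total_gain big_ord_recr/= lerDl.
Qed.

Lemma measurable_total_gain N : measurable_fun setT (total_gain N).
Proof. by apply: measurable_sum. Qed.

Lemma le_hit_time m w :
  (m.+1%:R%:E <= hit_time (G := G) i j w)%E <-> avoids X j 0 m w.
Proof.
split=> [le_hit s /andP[s0 sm] Xs|av].
  have : (hit_time (G := G) i j w <= s%:R%:E)%E.
    by apply: ereal_inf_lbound; exists s; split.
  move=> /(le_trans le_hit); rewrite lee_fin ler_nat.
  by rewrite ltnNge -[m]add0n sm.
apply/ereal_infP => _ [s [s1 Xs ->]].
rewrite lee_fin ler_nat ltnNge; apply/negP => sm.
by apply: (av s) => //; rewrite s1.
Qed.

Lemma total_gain_cvg w :
  (total_gain N w)%:E @[N --> \oo] --> tau (G := G) i j w.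
Proof.
pose u m := (step_weight G m w (X m.-1 w) (X m w))%:E.
pose p m := (m%:R%:E <= hit_time (G := G) i j w)%E.
rewrite -[tau _ _ _]/(\sum_(1 <= m <oo | p m) u m)%E.
have u_ge0 m : (1 <= m)%N -> p m -> (0 <= u m)%E.
  by case: m => // m _ _; rewrite lee_fin (step_weight_ge0 Gsupp).
have partialE N : (\sum_(1 <= m < N.+1 | p m) u m = (total_gain N w)%:E)%E.
  rewrite /total_gain big_add1/= big_mkord big_mkcond/= -sumEFin.
  apply: eq_bigr => m _; rewrite /p /gain indicE.
  case: ifPn => [/le_hit_time av|nav].
    by rewrite mem_set// mul1r.
  by rewrite memNset ?mul0r// => /le_hit_time; exact/negP.
have := is_cvg_nneseries_cond u_ge0.
rewrite -(cvg_shiftS (fun N => \sum_(1 <= m < N | p m) u m)%E).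
by under eq_fun do rewrite partialE.
Qed.

Local Notation b := (hadamard P (mean_weight G) *m @ones R n).
Local Notation b2 := (hadamard P (mean_weight2 G) *m @ones R n).
Local Notation QW := (hadamard Q (mean_weight G)).

Definition mean_iterate N : 'cV[R]_n := \sum_(m < N) Q ^+ m *m b.

(** The expectation of the increase of [total_gain ^+ 2] at step [N]: the square
    of the new gain and its products with the previous ones. *)
Definition mean2_increment N : 'cV[R]_n :=
  Q ^+ N *m b2 + 2 *: \sum_(m < N) Q ^+ m *m QW *m Q ^+ (N - m.+1) *m b.

Definition mean2_iterate N : 'cV[R]_n := \sum_(m < N) mean2_increment m.

Local Notation r := mean_iterate.
Local Notation s := mean2_iterate.

Lemma total_gain_mean N : (\int[Pr]_w (total_gain N w)%:E = (r N i 0)%:E)%E.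
Proof.
under eq_integral do rewrite /total_gain -sumEFin.
rewrite ge0_integral_sum//; last 2 first.
- by move=> m; exact/measurable_EFinP.
- by move=> m w _; rewrite lee_fin.
rewrite /mean_iterate summxE -sumEFin; apply: eq_bigr => m _.
by rewrite (gain_mean Gsupp Gfin Gstar) mulmxA.
Qed.

Lemma total_gain_mean2 N :
  (\int[Pr]_w (total_gain N w ^+ 2)%:E = (s N i 0)%:E)%E.
Proof.
elim: N => [|N ih].
  under eq_integral do rewrite /total_gain big_ord0 expr0n.
  by rewrite integral0 /mean2_iterate big_ord0 mxE.
transitivity (\int[Pr]_w ((total_gain N w ^+ 2)%:E + ((gain N w ^+ 2)%:E +
    2%:E * \sum_(m < N) (gain m w * gain N w)%:E)))%E.
  apply: eq_integral => w _; rewrite sumEFin -EFinM -!EFinD; congr (_%:E).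
  by rewrite -mulr_suml {1}/total_gain big_ord_recr/= -/(total_gain N w); ring.
have cross_ge0 w : (0 <= \sum_(m < N) (gain m w * gain N w)%:E)%E.
  by apply: sume_ge0 => m _; rewrite lee_fin mulr_ge0.
have mcross m : measurable_fun setT (fun w => (gain m w * gain N w)%:E).
  by apply/measurable_EFinP; exact: measurable_funM.
have msum : measurable_fun setT (fun w => \sum_(m < N) (gain m w * gain N w)%:E)%E.
  exact: emeasurable_sum.
rewrite ge0_integralD//; last 4 first.
- by move=> w _; rewrite lee_fin sqr_ge0.
- by apply/measurable_EFinP; apply: measurable_funX; exact: measurable_total_gain.
- by move=> w _; rewrite adde_ge0// ?lee_fin ?sqr_ge0// mule_ge0.
- apply: emeasurable_funD; last exact: measurable_funeM.
  by apply/measurable_EFinP; exact: measurable_funX.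
rewrite ih ge0_integralD//; last 4 first.
- by move=> w _; rewrite lee_fin sqr_ge0.
- by apply/measurable_EFinP; exact: measurable_funX.
- by move=> w _; rewrite mule_ge0.
- exact: measurable_funeM.
rewrite (gain_mean2 Gsupp Gfin Gstar) ge0_integralZl// ge0_integral_sum//; last first.
  by move=> m w _; rewrite lee_fin mulr_ge0.
have sE : s N.+1 i 0 = s N i 0 + ((Q ^+ N *m b2) i 0 +
    2 * \sum_(m < N) (Q ^+ m *m QW *m Q ^+ (N - m.+1) *m b) i 0).
  rewrite {1}/mean2_iterate big_ord_recr/= -/(s N) mxE; congr (_ + _).
  by rewrite mxE; congr (_ + _); rewrite mxE summxE.
rewrite sE (EFinD (s N i 0)) (EFinD ((Q ^+ N *m b2) i 0)) EFinM -sumEFin mulmxA.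
congr (_ + (_ + _ * _))%E; apply: eq_bigr => m _.
have mN : (m.+1 + (N - m.+1))%N = N by rewrite subnKC.
have := gain_cross Gsupp Gfin Gstar i j m (N - m.+1); rewrite mN => ->.
by rewrite !mulmxA.
Qed.


Lemma fpt_mean_lim (y : R) :
  r N i 0 @[N --> \oo] --> y -> fpt_mean G i j = y.
Proof.
move=> ry; rewrite mxE.
have cvg_int : (r N i 0)%:E @[N --> \oo] --> (\int[Pr]_w tau (G := G) i j w)%E.
  under eq_fun do rewrite -total_gain_mean.
  have -> : (\int[Pr]_w tau (G := G) i j w =
      \int[Pr]_w limn (fun N => (total_gain N w)%:E))%E.
    by apply: eq_integral => w _; apply/esym/cvg_lim => //; exact: total_gain_cvg.
  apply: cvg_monotone_convergence => // [N|N w _|w _ N N' NN'].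
  - by apply/measurable_EFinP; exact: measurable_total_gain.
  - by rewrite lee_fin total_gain_ge0.
  - by rewrite lee_fin total_gain_nd.
rewrite -(cvg_lim _ cvg_int)//.
have /(cvg_lim _) -> // : (r N i 0)%:E @[N --> \oo] --> y%:E.
by apply: cvg_EFin => //; exact: nearW.
Qed.

Lemma fpt_mean2_lim (y : R) :
  s N i 0 @[N --> \oo] --> y -> fpt_mean2 G i j = y.
Proof.
move=> sy; rewrite mxE.
have tau_ge0 w : (0 <= tau (G := G) i j w)%E.
  rewrite -(cvg_lim _ (@total_gain_cvg w))//.
  apply: lime_ge; first by apply/cvg_ex; exists (tau (G := G) i j w); exact: total_gain_cvg.
  by apply: nearW => N; rewrite lee_fin total_gain_ge0.
have sqr_cvg w : (total_gain N w ^+ 2)%:E @[N --> \oo] --> (tau (G := G) i j w ^+ 2)%E.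
  rewrite expe2; under eq_fun do rewrite expr2 EFinM.
  apply: cvgeM; [|exact: total_gain_cvg..].
  by have := tau_ge0 w; case: (tau _ _ w) => // t t0; rewrite /mule_def /= ?orbT.
have cvg_int : (s N i 0)%:E @[N --> \oo] --> (\int[Pr]_w (tau (G := G) i j w ^+ 2))%E.
  under eq_fun do rewrite -total_gain_mean2.
  have -> : (\int[Pr]_w (tau (G := G) i j w ^+ 2) =
      \int[Pr]_w limn (fun N => (total_gain N w ^+ 2)%:E))%E.
    by apply: eq_integral => w _; apply/esym/cvg_lim => //; exact: sqr_cvg.
  apply: cvg_monotone_convergence => // [N|N w _|w _ N N' NN'].
  - by apply/measurable_EFinP; apply: measurable_funX; exact: measurable_total_gain.
  - by rewrite lee_fin sqr_ge0.
  - by rewrite lee_fin ler_sqr ?nnegrE ?total_gain_ge0// total_gain_nd.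
rewrite -(cvg_lim _ cvg_int)//.
have /(cvg_lim _) -> // : (s N i 0)%:E @[N --> \oo] --> y%:E.
by apply: cvg_EFin => //; exact: nearW.
Qed.

Lemma mean_iterateS N : r N.+1 = b + Q *m r N.
Proof.
rewrite /mean_iterate big_ord_recl /= expr0 mul1mx; congr (_ + _).
by rewrite mulmx_sumr; apply: eq_bigr => m _; rewrite /bump /= add1n exprS -mulmxE !mulmxA.
Qed.

Lemma mean2_incrementS N :
  mean2_increment N.+1 = 2 *: (QW *m (Q ^+ N *m b)) + Q *m mean2_increment N.
Proof.
rewrite /mean2_increment big_ord_recl /= expr0 mul1mx subSS subn0.
rewrite scalerDr mulmxDr exprS -mulmxE !mulmxA addrCA; congr (_ + (_ + _)).
rewrite -scalemxAr mulmx_sumr; congr (_ *: _); apply: eq_bigr => m _.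
by rewrite /bump /= add1n subSS exprS -mulmxE !mulmxA.
Qed.

(** The increments are sums over the times of the two gains; splitting off the
    earlier gain at time [0] shifts the remaining ones and gives a first-step
    recursion, which passes to the limit. *)
Lemma mean2_iterateS N : s N.+1 = (b2 + 2 *: (QW *m r N)) + Q *m s N.
Proof.
rewrite /mean2_iterate big_ord_recl /=.
under eq_bigr do rewrite /bump /= add1n mean2_incrementS.
rewrite big_split /= -scaler_sumr -!mulmx_sumr addrA.
by rewrite {1}/mean2_increment expr0 mul1mx big_ord0 scaler0 addr0.
Qed.

End fixed_endpoints.

Hypotheses (Psto : stochastic P) (Pirr : irreducible P).
Local Notation J := (@ones R n *m (@ones R n)^T).
Local Notation M := (fpt_mean G).
Local Notation M2 := (fpt_mean2 G).

Lemma mean_weight_ge0 a c : 0 <= mean_weight G a c.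
Proof.
rewrite -lee_fin -(mean_weightP Gsupp Gfin); apply: integral_ge0 => w _.
by rewrite lee_fin (weight_ge0 Gsupp).
Qed.

Lemma mean_weight2_ge0 a c : 0 <= mean_weight2 G a c.
Proof.
rewrite -lee_fin -(mean_weight2P Gsupp Gfin); apply: integral_ge0 => w _.
by rewrite lee_fin sqr_ge0.
Qed.

Let P_ge0 a c : 0 <= P a c. Proof. by case: Psto. Qed.

Let row_sum_ge0 (U : 'M[R]_n) a : (forall a c, 0 <= U a c) ->
  0 <= (hadamard P U *m ones) a 0.
Proof.
by move=> U0; rewrite mxE sumr_ge0// => c _; rewrite !mxE mulr1 mulr_ge0.
Qed.

Lemma fpt_mean_iterate_cvg j :
  [/\ forall a, nondecreasing_seq (fun N => mean_iterate j N a 0),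
      forall a, mean_iterate j N a 0 @[N --> \oo] --> M a j
    & col j M = hadamard P (mean_weight G) *m ones + taboo P j *m col j M].
Proof.
have [r_nd [y ry yE]] := @taboo_iteration_cvg _ _ P j Psto Pirr
  (mean_iterate j) (fun=> hadamard P (mean_weight G) *m ones)
  (hadamard P (mean_weight G) *m ones) (big_ord0 _ _ _ _)
  (mean_iterateS j) (fun N a => row_sum_ge0 a mean_weight_ge0)
  (fun a _ _ _ => lexx _) (fun a => cvg_cst _).
have yM : col j M = y.
  by apply/matrixP => a c; rewrite ord1 mxE (fpt_mean_lim (ry a)).
by split=> [//|a|]; rewrite ?yM// (fpt_mean_lim (ry a)).
Qed.

Lemma fpt_mean2_col j :
  col j M2 = (hadamard P (mean_weight2 G) *m ones +
    2 *: (hadamard (taboo P j) (mean_weight G) *m col j M)) +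
    taboo P j *m col j M2.
Proof.
set QW := hadamard (taboo P j) _; set b2 := hadamard P _ *m ones.
have [r_nd rM _] := fpt_mean_iterate_cvg j.
have r_ge0 N a : 0 <= mean_iterate j N a 0.
  by have := r_nd a 0%N N (leq0n N); rewrite {1}/mean_iterate big_ord0 mxE.
have QW_ge0 a c : 0 <= QW a c.
  by rewrite mxE mulr_ge0 ?mean_weight_ge0// taboo_ge0.
have rM' a : mean_iterate j N a 0 @[N --> \oo] --> (col j M) a 0.
  by rewrite mxE; exact: rM.
have QWr N a : (b2 + 2 *: (QW *m mean_iterate j N)) a 0 =
    b2 a 0 + 2 * (QW *m mean_iterate j N) a 0.
  by rewrite mxE; congr (_ + _); rewrite mxE.
have [|||_ [y sy yE]] := @taboo_iteration_cvg _ _ P j Psto Pirr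
  (mean2_iterate j) (fun N => b2 + 2 *: (QW *m mean_iterate j N))
  (b2 + 2 *: (QW *m col j M)) (big_ord0 _ _ _ _) (mean2_iterateS j).
- move=> N a; rewrite QWr addr_ge0 ?row_sum_ge0// ?mulr_ge0//.
    exact: mean_weight2_ge0.
  by rewrite mxE sumr_ge0// => c _; rewrite mulr_ge0.
- move=> a N N' NN'; rewrite !QWr lerD2l ler_wpM2l// !mxE.
  by apply: ler_sum => c _; rewrite ler_wpM2l//; exact: r_nd.
- move=> a; have -> : (b2 + 2 *: (QW *m col j M)) a 0 =
      b2 a 0 + 2 * (QW *m col j M) a 0.
    by rewrite mxE; congr (_ + _); rewrite mxE.
  under eq_fun do rewrite QWr.
  apply: cvgD; first exact: cvg_cst.
  by apply: cvgM; [exact: cvg_cst|exact: cvg_mulmx_col].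
suff -> : col j M2 = y by [].
by apply/matrixP => a c; rewrite ord1 mxE (fpt_mean2_lim (sy a)).
Qed.

Let J_entry (A : 'M[R]_n) a c : (A *m J) a c = (A *m ones) a 0.
Proof.
have onesT : (@ones R n)^T 0 c = 1 by rewrite !mxE.
by rewrite mulmxA mxE big_ord1 onesT mulr1.
Qed.

Lemma fpt_mean_eq :
  M = hadamard P (mean_weight G) *m J + P *m (M - dg M).
Proof.
apply/matrixP => a j; have [_ _ /matrixP/(_ a 0)] := fpt_mean_iterate_cvg j.
rewrite mxE => ->; rewrite col_taboo mxE [RHS]mxE J_entry.
by congr (_ + _); rewrite [RHS]mxE.
Qed.

Lemma fpt_mean2_eq :
  M2 = (hadamard P (mean_weight2 G) *m J +
        2 *: (hadamard P (mean_weight G) *m (M - dg M))) + P *m (M2 - dg M2).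
Proof.
have QW j : hadamard (taboo P j) (mean_weight G) =
    taboo (hadamard P (mean_weight G)) j.
  by apply/matrixP => a c; rewrite !mxE; case: eqP; rewrite ?mul0r.
apply/matrixP => a j; have /matrixP/(_ a 0) := fpt_mean2_col j.
rewrite mxE => ->; rewrite !col_taboo QW mxE [RHS]mxE; congr (_ + _).
  rewrite mxE [RHS]mxE J_entry; congr (_ + _).
  by rewrite mxE [RHS]mxE; congr (_ * _); rewrite [RHS]mxE.
by rewrite [RHS]mxE.
Qed.

End passage_time_equations.

(** * Differentiation along a line of weight matrices *)

Section derivative_along_a_line.
Context {R : realType} {n : nat}.
Implicit Types (F w : 'M[R]_n -> 'M[R]_n) (W v : 'M[R]_n).

Lemma linear_mx_continuous (L : {linear 'M[R]_n -> 'M[R]_n}) : continuous L.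
Proof.
move=> X.
have LE : (L : 'M[R]_n -> 'M[R]_n) = fun Y => \sum_i \sum_j Y i j *: L (delta_mx i j).
  apply/funext => Y; rewrite {1}(matrix_sum_delta Y) linear_sum.
  by apply: eq_bigr => i _; rewrite linear_sum; apply: eq_bigr => j _; rewrite linearZ.
rewrite LE /continuous_at.
have FX : Filter (nbhs X) by exact: nbhs_filter.
have coord i j : (fun Y : 'M[R]_n => Y i j) @ nbhs X --> X i j.
  exact: coord_continuous.
move: (nbhs X) FX coord => F FX coord.
apply: cvg_big => [|i _]; first exact: add_continuous.
apply: cvg_big => [|j _]; first exact: add_continuous.
by apply: cvgZr_tmp; exact: coord.
Qed.

(** This is the form that the moments of the passage times take along the line
    [W + t v]: [w] is the matrix of second moments of the weights, of which
    nothing is known beyond its derivative in the direction [v], and the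
    dependence on the means is polynomial in [t]. *)
Lemma derive_line F w W v (L : {linear 'M[R]_n -> 'M[R]_n}) (C C' : 'M[R]_n) :
  derivable w W v ->
  (\forall t \near (0 : R), F (t *: v + W) =
    F W + t *: C + t ^+ 2 *: C' + L (w (t *: v + W) - w W)) ->
  derivable F W v /\ 'D_v F W = C + L ('D_v w W).
Proof.
move=> dw FE.
have cvgF : (fun t => t^-1 *: ((F \o shift W) (t *: v) - F W)) @ 0^' -->
    C + L ('D_v w W).
  have near_eq : {near (0 : R)^', (fun t => C + t *: C' +
      L (t^-1 *: ((w \o shift W) (t *: v) - w W))) =1
      (fun t => t^-1 *: ((F \o shift W) (t *: v) - F W))}.
    near=> t.
    have t0 : t != 0 by near: t; exact: nbhs_dnbhs_neq.
    have -> : (F \o shift W) (t *: v) =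
        F W + t *: C + t ^+ 2 *: C' + L (w (t *: v + W) - w W).
      by near: t; exact: nbhs_dnbhs.
    rewrite linearZ /= /shift; move: (L _) => X.
    by apply/matrixP => a b; rewrite !mxE; field.
  apply: cvg_trans; first exact: (near_eq_cvg near_eq).
  have -> : C + L ('D_v w W) = C + 0 *: C' + L ('D_v w W).
    by rewrite scale0r addr0.
  apply: cvgD; first apply: cvgD.
  - exact: cvg_cst.
  - apply: cvgZr_tmp.
    by apply: cvg_within_filter; exact: cvg_id.
  - by apply: continuous_cvg; [exact: linear_mx_continuous|exact: dw].
split; first exact: cvgP cvgF.
exact: cvg_lim cvgF.
Unshelve. all: by end_near. Qed.

End derivative_along_a_line.

(** * Linearity in the right-hand side *)

Section linear_operators.
Context {R : realType} {n : nat}.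
Implicit Types (A B P : 'M[R]_n) (pi : 'rV[R]_n) (l k : 'I_n).
Local Notation J := (@ones R n *m (@ones R n)^T).

Lemma hadamard_is_linear A : linear (hadamard A).
Proof. by move=> a X Y; apply/matrixP => i j; rewrite !mxE mulrDr mulrCA. Qed.

HB.instance Definition _ A :=
  GRing.isLinear.Build R 'M[R]_n 'M[R]_n *:%R (hadamard A) (hadamard_is_linear A).

Lemma dg_is_linear : linear (@dg R n).
Proof.
move=> a X Y; apply/matrixP => i j; rewrite !mxE.
by case: eqP; rewrite ?mulr0 ?addr0.
Qed.

HB.instance Definition _ :=
  GRing.isLinear.Build R 'M[R]_n 'M[R]_n *:%R (@dg R n) dg_is_linear.

Lemma dgD A B : dg (A + B) = dg A + dg B.
Proof. exact: linearD. Qed.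

Lemma dgZ a A : dg (a *: A) = a *: dg A.
Proof. exact: linearZ. Qed.

(** The part of [fpt_solution] that vanishes on the diagonal. *)
Definition centred_potential P pi B : 'M[R]_n :=
  Zmx P pi *m B - J *m dg (Zmx P pi *m B).

Lemma centred_potential_is_linear P pi : linear (centred_potential P pi).
Proof.
move=> a X Y; rewrite /centred_potential mulmxDr -scalemxAr linearP mulmxDr -scalemxAr.
by rewrite scalerBr opprD addrACA.
Qed.

HB.instance Definition _ P pi :=
  GRing.isLinear.Build R 'M[R]_n 'M[R]_n *:%R (centred_potential P pi)
    (centred_potential_is_linear P pi).

Lemma centred_potentialD P pi A B : centred_potential P pi (A + B) =
  centred_potential P pi A + centred_potential P pi B.
Proof. exact: linearD. Qed.

Lemma centred_potentialZ P pi a A :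
  centred_potential P pi (a *: A) = a *: centred_potential P pi A.
Proof. exact: linearZ. Qed.

Lemma fpt_solution_is_linear P pi : linear (fpt_solution P pi).
Proof.
move=> a X Y; rewrite /fpt_solution -!/(centred_potential P pi _) linearP.
have -> : diag_mx (\row_j ((pi *m (a *: X + Y)) 0 j / pi 0 j)) =
    a *: diag_mx (\row_j ((pi *m X) 0 j / pi 0 j)) +
    diag_mx (\row_j ((pi *m Y) 0 j / pi 0 j)) :> 'M[R]_n.
  rewrite -linearP; congr diag_mx; apply/rowP => j.
  rewrite mulmxDr -scalemxAr; move: (pi *m X) (pi *m Y) => p q.
  by rewrite !mxE mulrDl mulrA.
by rewrite mulmxDr -scalemxAr scalerDr addrACA.
Qed.

HB.instance Definition _ P pi :=
  GRing.isLinear.Build R 'M[R]_n 'M[R]_n *:%R (fpt_solution P pi)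
    (fpt_solution_is_linear P pi).

Lemma fpt_solutionE P pi B :
  fpt_solution P pi B = centred_potential P pi B +
    (1%:M - Zmx P pi + J *m dg (Zmx P pi)) *m dg (fpt_solution P pi B).
Proof.
rewrite {1}/fpt_solution -/(centred_potential P pi B); congr (_ + _ *m _).
apply/matrixP => i j; rewrite [LHS]mxE [RHS]mxE.
have [->|_] := eqVneq i j; last by rewrite mulr0n.
by rewrite fpt_solution_diag mxE mulr1n.
Qed.

(** The second-moment right-hand side along the line: the means of the weights
    and [M - dg M] are both affine in [t]. *)
Lemma mulmx_affine (K K' U U' N N' : 'M[R]_n) (t : R) :
  K' + 2 *: ((U + t *: U') *m (N + t *: N')) =
  (K + 2 *: (U *m N)) + t *: (2 *: (U *m N' + U' *m N)) +
  t ^+ 2 *: (2 *: (U' *m N')) + (K' - K).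
Proof.
rewrite mulmxDl !mulmxDr -!scalemxAl -!scalemxAr.
move: (U *m N) (U *m N') (U' *m N) (U' *m N') => X1 X2 X3 X4.
by apply/matrixP => a b; rewrite !mxE; ring.
Qed.

Lemma hadamard_sqr_affine (U U' X C C' Y : 'M[R]_n) (t : R) :
  X + t *: C + t ^+ 2 *: C' + Y - hadamard (U + t *: U') (U + t *: U') =
  X - hadamard U U + t *: (C - 2 *: hadamard U U') +
  t ^+ 2 *: (C' - hadamard U' U') + Y.
Proof. by apply/matrixP => a b; rewrite !mxE; ring. Qed.

Lemma hadamard_delta P l k : hadamard P (delta_mx l k) = P l k *: delta_mx l k.
Proof.
apply/matrixP => i j; rewrite !mxE.
by case: eqP => [->|]; case: eqP => [->|]; rewrite //= ?mulr0.
Qed.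

Lemma delta_mx_evec l k : delta_mx l k = evec l *m (@evec R n k)^T.
Proof. by rewrite /evec trmx_delta mul_delta_mx. Qed.

Lemma delta_mx_ones l k : delta_mx l k *m ones = evec l :> 'cV[R]_n.
Proof.
apply/matrixP => i j; rewrite mxE (bigD1 k)//= big1 ?addr0.
  by rewrite !ord1 !mxE !eqxx !andbT mulr1.
by move=> c ck; rewrite !mxE (negPf ck) andbF mul0r.
Qed.

Lemma mul_row_evec pi l : pi *m evec l = (pi 0 l)%:M :> 'M[R]_1.
Proof.
apply/matrixP => i j; rewrite !ord1 mxE (bigD1 l)//= big1 ?addr0.
  by rewrite !mxE !eqxx mulr1.
by move=> c cl; rewrite !mxE (negPf cl) mulr0.
Qed.

End linear_operators.

(** * Derivatives of the passage-time moments *)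

Section fpt_solutions.
Context {R : realType} {n : nat} {P : 'M[R]_n} (E : rel 'I_n) (pi : 'rV[R]_n)
  (G : realization P).
Hypotheses (graph : weighted_markovian_graph E G) (Gpi : assumption_A E pi G)
  (Gstar : assumption_Astar G).
Local Notation J := (@ones R n *m (@ones R n)^T).
Local Notation M := (fpt_mean G).

Let Gsupp : weight_support E G. Proof. by case: graph. Qed.
Let Gfin : finite_moments E G. Proof. by case: Gpi. Qed.
Let Psto : stochastic P. Proof. by case: graph => -[]. Qed.
Let Pirr : irreducible P. Proof. by case: graph => -[]. Qed.
Let pi_stat : stationary P pi. Proof. by case: Gpi => -[]. Qed.

Lemma fpt_mean_solution :
  M = fpt_solution P pi (hadamard P (mean_weight G) *m J).
Proof.
exact: (fpt_solutionP Psto Pirr pi_stat (fpt_mean_eq Gsupp Gfin Gstar Psto Pirr)).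
Qed.

Lemma fpt_mean2_solution :
  fpt_mean2 G = fpt_solution P pi (hadamard P (mean_weight2 G) *m J +
    2 *: (hadamard P (mean_weight G) *m (M - dg M))).
Proof.
exact: (fpt_solutionP Psto Pirr pi_stat (fpt_mean2_eq Gsupp Gfin Gstar Psto Pirr)).
Qed.

End fpt_solutions.

Lemma invmx_Xi (R : realType) (n : nat) (pi : 'rV[R]_n) :
  (forall i, 0 < pi 0 i) -> invmx (Xi pi) = diag_mx (\row_j (pi 0 j)^-1).
Proof.
move=> pi_gt0; set D := diag_mx _.
have XD : Xi pi *m D = 1%:M.
  apply/matrixP => i j; rewrite mul_diag_mx !mxE.
  by case: eqP => [->|_]; rewrite ?mulr0n ?mulr0// mulr1n mulfV// gt_eqF.
have [uX _] := mulmx1_unit XD.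
by rewrite -[LHS]mulmx1 -XD mulmxA mulVmx// mul1mx.
Qed.

Theorem theorem3 (R : realType) (n : nat) (E : rel 'I_n) (P : 'M[R]_n)
    (pi : 'rV[R]_n) (D : set 'M[R]_n) (G : 'M[R]_n -> realization P)
    (hG : forall W', D W' ->
      [/\ weighted_markovian_graph E (G W'),
          assumption_A E pi (G W'),
          assumption_Astar (G W')
        & mean_weight (G W') = W'])
    (l k : 'I_n) (hlk : E l k) (W : 'M[R]_n)
    (hD : \forall t \near (0 : R), D (W + t *: delta_mx l k))
    (hW2 : derivable (fun W' => mean_weight2 (G W')) W (delta_mx l k)) :
  let d (F : 'M[R]_n -> 'M[R]_n) : 'M[R]_n := 'D_(delta_mx l k) F W in
  let M := fpt_mean (G W) in
  let Z := Zmx P pi in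
  let J : 'M[R]_n := ones *m ones^T in
  let dM := d (fun W' => fpt_mean (G W')) in
  let dM2 := d (fun W' => fpt_mean2 (G W')) in
  let dV := d (fun W' => fpt_var (G W')) in
  let A := d (fun W' => hadamard P (mean_weight2 (G W'))) in
  let dM2dg := d (fun W' => dg (fpt_mean2 (G W'))) in
  let PW := hadamard P W in
  [/\ derivable (fun W' => fpt_mean (G W')) W (delta_mx l k),
      derivable (fun W' => fpt_mean2 (G W')) W (delta_mx l k)
    & derivable (fun W' => fpt_var (G W')) W (delta_mx l k)] /\
  [/\ dV = dM2 - 2 *: hadamard M dM,
      dM = P l k *:
        (Z *m evec l *m ones^T - J *m dg (Z *m evec l *m ones^T)
         + pi 0 l *: ((1%:M - Z + J *m dg Z) *m invmx (Xi pi))),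
      dM2 =
        Z *m A *m ones *m ones^T - J *m dg (Z *m A *m ones *m ones^T)
        + (2 * P l k) *:
            (Z *m evec l *m (evec k)^T *m (M - dg M)
             - J *m dg (Z *m evec l *m (evec k)^T *m (M - dg M)))
        + 2 *: (Z *m PW *m (dM - dg dM) - J *m dg (Z *m PW *m (dM - dg dM)))
        + (1%:M - Z + J *m dg Z) *m dM2dg
    & forall i : 'I_n,
        'D_(delta_mx l k) (fun W' => fpt_mean2 (G W') i i) W =
          (pi *m A *m ones) 0 0 / pi 0 i
          + 2 * pi 0 l * P l k * (M - dg M) k i / pi 0 i
          + 2 * (pi *m PW *m (dM - dg dM)) 0 i / pi 0 i].
Proof.
move=> d M Z J dM dM2 dV A dM2dg PW.
set v := delta_mx l k in hD hW2 d dM dM2 dV A dM2dg *.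
pose w2 W' := mean_weight2 (G W').
have DW : D W by have := nbhs_singleton hD; rewrite scale0r addr0.
have [graphW AW starW meanW] := hG W DW.
have Psto : stochastic P by case: graphW => -[].
have Pirr : irreducible P by case: graphW => -[].
have pi_stat : stationary P pi by case: AW => -[].
have pi_gt0 := stationary_gt0 Psto Pirr pi_stat.
pose Phi := fpt_solution P pi.
pose Pv : 'M[R]_n := hadamard P v.
pose zero : {linear 'M[R]_n -> 'M[R]_n} := \0%R.
(* On D both moments are images under the solution operator. *)
have ME W' : D W' -> fpt_mean (G W') = Phi (hadamard P W' *m J).
  by move=> /hG[g a s m]; rewrite (fpt_mean_solution g a s) m.
have M2E W' : D W' -> fpt_mean2 (G W') = Phi (hadamard P (w2 W') *m J +
    2 *: (hadamard P W' *m (fpt_mean (G W') - dg (fpt_mean (G W'))))).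
  by move=> /hG[g a s m]; rewrite (fpt_mean2_solution g a s) m.
have nearD : \forall t \near (0 : R), D (t *: v + W).
  by apply: filterS hD => t; rewrite addrC.
have PWt t : hadamard P (t *: v + W) = PW + t *: Pv.
  by rewrite linearP addrC.
pose dM0 := Phi (Pv *m J).
have Mt t : D (t *: v + W) -> fpt_mean (G (t *: v + W)) = M + t *: dM0.
  move=> Dt; rewrite /M (ME W)// ME// PWt mulmxDl -scalemxAl.
  by rewrite /Phi linearD linearZ.
have [derM dM_E] : derivable (fun W' => fpt_mean (G W')) W v /\
    dM = dM0 + zero ('D_v w2 W).
  apply: (@derive_line _ _ _ w2 _ _ zero _ 0) => //.
  apply: filterS nearD => t Dt.
  by rewrite Mt// scaler0 !addr0.
rewrite addr0 in dM_E.
pose N := M - dg M.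
pose dN := dM - dg dM.
have Nt t : D (t *: v + W) ->
    fpt_mean (G (t *: v + W)) - dg (fpt_mean (G (t *: v + W))) = N + t *: dN.
  by move=> Dt; rewrite Mt// -dM_E linearD linearZ /= opprD addrACA -scalerBr.
pose L : {linear 'M[R]_n -> 'M[R]_n} :=
  [the {linear _ -> _} of fpt_solution P pi] \o
  ([the {linear _ -> _} of mulmxr J] \o [the {linear _ -> _} of hadamard P]).
pose C := Phi (2 *: (PW *m dN + Pv *m N)).
pose C' := Phi (2 *: (Pv *m dN)).
have M2t t : D (t *: v + W) -> fpt_mean2 (G (t *: v + W)) =
    fpt_mean2 (G W) + t *: C + t ^+ 2 *: C' + L (w2 (t *: v + W) - w2 W).
  move=> Dt; rewrite M2E// (M2E W)// Nt// PWt -/M -/N -/PW.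
  set w2t := w2 (t *: v + W).
  have -> : hadamard P w2t *m J + 2 *: ((PW + t *: Pv) *m (N + t *: dN)) =
      (hadamard P (w2 W) *m J + 2 *: (PW *m N)) +
      t *: (2 *: (PW *m dN + Pv *m N)) + t ^+ 2 *: (2 *: (Pv *m dN)) +
      hadamard P (w2t - w2 W) *m J.
    have -> : hadamard P (w2t - w2 W) = hadamard P w2t - hadamard P (w2 W).
      exact: linearB.
    by rewrite mulmxBl -mulmx_affine.
  by rewrite /Phi 3!linearD; congr (_ + _ + _ + _); rewrite linearZ.
have nearM2 : \forall t \near (0 : R), fpt_mean2 (G (t *: v + W)) =
    fpt_mean2 (G W) + t *: C + t ^+ 2 *: C' + L (w2 (t *: v + W) - w2 W).
  by apply: filterS nearD => t; exact: M2t.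
have [derM2 dM2_E] : derivable (fun W' => fpt_mean2 (G W')) W v /\
    dM2 = C + L ('D_v w2 W).
  exact: derive_line hW2 nearM2.
(* The variance differs from M2 by the square of an affine function of t. *)
have nearV : \forall t \near (0 : R), fpt_var (G (t *: v + W)) =
    fpt_var (G W) + t *: (C - 2 *: hadamard M dM) +
    t ^+ 2 *: (C' - hadamard dM dM) + L (w2 (t *: v + W) - w2 W).
  apply: filterS nearD => t Dt; rewrite /fpt_var M2t// Mt// -dM_E -/M.
  exact: hadamard_sqr_affine.
have [derV dV_E] : derivable (fun W' => fpt_var (G W')) W v /\
    dV = (C - 2 *: hadamard M dM) + L ('D_v w2 W).
  exact: derive_line hW2 nearV.
have A_E : A = hadamard P ('D_v w2 W).
  have nearA : \forall t \near (0 : R), hadamard P (w2 (t *: v + W)) =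
      hadamard P (w2 W) + t *: 0 + t ^+ 2 *: 0 +
      hadamard P (w2 (t *: v + W) - w2 W).
    apply: filterS nearD => t _; rewrite !scaler0 !addr0 -[RHS]linearD.
    by rewrite [w2 W + _]addrC subrK.
  have [_] := derive_line (F := fun W' => hadamard P (w2 W'))
    (L := [the {linear _ -> _} of hadamard P]) hW2 nearA.
  by rewrite add0r; exact.
have dM2dg_E : dM2dg = dg dM2.
  have neardg : \forall t \near (0 : R), dg (fpt_mean2 (G (t *: v + W))) =
      dg (fpt_mean2 (G W)) + t *: dg C + t ^+ 2 *: dg C' +
      dg (L (w2 (t *: v + W) - w2 W)).
    by apply: filterS nearM2 => t ->; rewrite 3!dgD 2!dgZ.
  have [_] := derive_line (F := fun W' => dg (fpt_mean2 (G W')))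
    (L := [the {linear _ -> _} of @dg R n] \o L) hW2 neardg.
  by rewrite dM2_E dgD; exact.
(* The derivative of the right-hand side of the equation of M2. *)
pose dB := A *m J + 2 *: (PW *m dN + P l k *: (evec l *m (evec k)^T *m N)).
have dM2_sol : dM2 = Phi dB.
  rewrite dM2_E /C /L /= -A_E /Phi -linearD addrC /Pv hadamard_delta.
  by rewrite -scalemxAl delta_mx_evec.
have PvJ : Pv *m J = P l k *: (evec l *m ones^T).
  by rewrite /Pv hadamard_delta -scalemxAl /J mulmxA delta_mx_ones.
split; first by split.
split.
- rewrite dV_E dM2_E; move: (L _) => X.
  by rewrite addrAC.
- rewrite dM_E /dM0 PvJ /Phi linearZ /=; congr (_ *: _).
  rewrite /fpt_solution invmx_Xi// -!mulmxA; congr (_ + _).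
  rewrite -/Z scalemxAr; congr (_ *m _).
  rewrite mulmxA mul_row_evec; apply/matrixP => a b.
  rewrite mul_scalar_mx !mxE mulr1.
  by case: eqP; rewrite ?mulr1n ?mulr0n ?mulr0.
- rewrite dM2dg_E dM2_sol [LHS]fpt_solutionE -/Phi; congr (_ + _).
  have -> : Z *m A *m ones *m ones^T = Z *m (A *m J) by rewrite /J !mulmxA.
  have -> : Z *m evec l *m (evec k)^T *m (M - dg M) =
      Z *m (evec l *m (evec k)^T *m N) by rewrite !mulmxA.
  have -> : Z *m PW *m (dM - dg dM) = Z *m (PW *m dN) by rewrite mulmxA.
  rewrite -!/(centred_potential P pi _) /dB.
  move: (A *m J) (PW *m dN) (evec l *m _ *m _) => X Y U.
  rewrite centred_potentialD centred_potentialZ centred_potentialD centred_potentialZ.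
  by rewrite scalerDr scalerA [2 *: _ + _]addrC addrA.
- move=> i.
  have -> : 'D_v (fun W' => fpt_mean2 (G W') i i) W = dM2 i i.
    by rewrite /dM2 /d derive_mx// mxE.
  have AJ : (pi *m (A *m J)) 0 i = (pi *m A *m ones) 0 0.
    by rewrite /J !mulmxA mxE big_ord1 !mxE mulr1.
  have eN : (pi *m (evec l *m (evec k)^T *m N)) 0 i = pi 0 l * N k i.
    rewrite !mulmxA mul_row_evec -mulmxA mul_scalar_mx mxE.
    by rewrite trmx_delta -rowE mxE.
  have dBi : (pi *m dB) 0 i = (pi *m A *m ones) 0 0 +
      2 * ((pi *m PW *m dN) 0 i + P l k * (pi 0 l * N k i)).
    rewrite /dB mulmxDr -scalemxAr mulmxDr -scalemxAr -AJ -eN (mulmxA pi PW).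
    move: (pi *m (A *m J)) (pi *m PW *m dN) (pi *m (_ *m N)) => x y z.
    by rewrite !mxE.
  by rewrite dM2_sol fpt_solution_diag dBi -/N -/dN; ring.
Qed.
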